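(* Let $L\subset\mathbb{Z}^n$ be a lattice and $S$ a subset of $I_L$ consisting of binomials. The set $S$ is a cardinality-minimal generating set of $I_L$ if and only if the following conditions are satisfied: (i) $\Gamma_{\overline F}(S)$ is a spanning tree of $\Gamma_{\overline F}$ for every $I_L$-fiber $F$, and $|S_{\overline F}|=t(\overline F)-1$ for every $I_L$-fiber $F$ such that $F\notin\overline{F}_{\{1\}}$; (ii) $|S_{\overline{F}_{\{1\}}}|=\operatorname{rank}(L_{pure})$; (iii) $I_{L_{pure}}=\langle S_{\overline{F}_{\{1\}}}\rangle$.
   Context: Let $\Bbbk$ be a field, $R=\Bbbk[x_1,\ldots,x_n]$, $\mathbb{N}=\mathbb{Z}_{\ge 0}$, $[n]=\{1,\dots,n\}$. A lattice is a subgroup $L\subset\mathbb{Z}^n$; its lattice ideal is $I_L=\langle x^{u}-x^{v}: u,v\in\mathbb{N}^n,\ u-v\in L\rangle\subset R$. A binomial means a difference $x^u-x^v$ of two distinct monomials. A minimal generating set of $I_L$ is a set of binomials that is a minimal (under inclusion) system of generators of $I_L$; it is a cardinality-minimal generating set if it has the least cardinality among all minimal generating sets. $L^+=L\cap\mathbb{N}^n$; $L_{pure}$ is the subgroup of $L$ generated by $L^+$; $\operatorname{supp}(u)=\{i:u_i\ne0\}$; $\sigma=\bigcup_{w\in L^+}\operatorname{supp}(w)\subset[n]$. For $u\in\mathbb{Z}^n$, $u^\sigma=(u_i)_{i\notin\sigma}$ (with $u^{[n]}=0$ if $\sigma=[n]$). An $I_L$-fiber is a set of the form $F_u=\{x^v: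 v\in\mathbb{N}^n,\ v-u\in L\}$ with $u\in\mathbb{N}^n$. For a binomial $B=x^u-x^v\in I_L$, $F_B:=F_u=F_v$. $F_{\{1\}}$ is the fiber containing $1$. Fibers $F,G$ are equivalent if there are $u,v\in\mathbb{N}^n$ with $x^uF\subset G$ and $x^vG\subset F$; $\overline F$ denotes the equivalence class of $F$. Write $\overline F\le_{I_L}\overline G$ if there is $u\in\mathbb{N}^n$ with $x^uF\subset G$ (a well-defined partial order on classes), and $\overline F<_{I_L}\overline G$ if moreover $\overline F\ne\overline G$. Let $I_{L,<\overline F}$ (resp. $I_{L,\le\overline F}$) be the ideal generated by all binomials $B\in I_L$ with $\overline{F_B}<_{I_L}\overline F$ (resp. $\overline{F_B}\le_{I_L}\overline F$); it is $0$ if there are no such binomials. For a set $S$ of binomials of $I_L$, $S_{\overline F}=\{B\in S:\overline{F_B}=\overline F\}$. Let $M_F$ be the monomial ideal generated by the elements of $F$, $G(M_F)$ its minimal set of monomial generators, and $G(M_F)^\sigma=\{x^{u^\sigma}:x^u\in G(M_F)\}=\{x^{a_1^\sigma},\ldots,x^{a_k^\sigma}\}$ (distinct elements, with $x^{a_i}\in G(M_F)$). The graph $G_{\overline F}$ has vertex set $[k]$, and $\{i,j\}$ is an edge iff there exist $x^{u_i},x^{u_j}\in F$ with $u_i^\sigma=a_i^\sigma$, $u_j^\sigma=a_j^\sigma$ and $x^{u_i}-x^{u_j}\in I_{L,<\overline F}$ (independent, up to reordering of vertices, of the representative $F$ of $\overline F$). $\Gamma_{\overline F}$ is the complete graph whose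 vertices are the connected components of $G_{\overline F}$, and $t(\overline F)$ is its number of vertices. A binomial $B=x^u-x^v\in I_L$ with $F_B\in\overline F$, $x^{u^\sigma}\ne x^{v^\sigma}$, $B\in I_{L,\le\overline F}$ and $B\notin I_{L,<\overline F}$ is identified with the edge of $\Gamma_{\overline F}$ joining the components of the vertices corresponding to $x^{u^\sigma}$ and $x^{v^\sigma}$. For a set $S$ of binomials of $I_L$, $\Gamma_{\overline F}(S)$ is the subgraph of $\Gamma_{\overline F}$ (on all its vertices) whose edges are those given by the binomials $B\in S$ with $F_B\in\overline F$. *)

(* Defs.v *)
From HB Require Import structures.
From mathcomp Require Import all_boot all_algebra finmap.
From mathcomp Require Import boolp classical_sets functions cardinality.
From mathcomp Require Import mpoly.

Set Implicit Arguments.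
Unset Strict Implicit.
Unset Printing Implicit Defensive.

Import GRing.Theory.
Local Open Scope ring_scope.
Local Open Scope classical_set_scope.

Definition is_lattice (n : nat) (L : set 'rV[int]_n) : Prop :=
  L 0 /\ forall u v, L u -> L v -> L (u - v).

Definition lattice_plus (n : nat) (L : set 'rV[int]_n) : set 'rV[int]_n :=
  L `&` [set w : 'rV[int]_n | forall i, 0 <= w ord0 i].

Definition lattice_pure (n : nat) (L : set 'rV[int]_n) : set 'rV[int]_n :=
  smallest (@is_lattice n) (lattice_plus L).

Definition Zbasis (n r : nat) (L : set 'rV[int]_n) (b : 'M[int]_(r, n)) : Prop :=
  injective (fun c : 'rV[int]_r => c *m b)
  /\ L = range (fun c : 'rV[int]_r => c *m b).

(* A lattice is a free abelian group, so the default value 0 of [xget] is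
   never used on lattices; the size of a basis does not depend on the basis. *)
Definition lattice_rank (n : nat) (L : set 'rV[int]_n) : nat :=
  xget 0%N [set r | exists b : 'M[int]_(r, n), Zbasis L b].

Definition lattice_sigma (n : nat) (L : set 'rV[int]_n) : set 'I_n :=
  \bigcup_(w in lattice_plus L) [set i | w ord0 i != 0].

(* Exponent vectors restricted to the coordinates outside sigma. *)
Definition svec (n : nat) (L : set 'rV[int]_n) : choiceType :=
  {ffun {i : 'I_n | i \notin lattice_sigma L} -> nat}.

Definition restr_sigma (n : nat) (L : set 'rV[int]_n) (u : 'X_{1..n}) : svec L :=
  [ffun i => u (val i)].
Arguments restr_sigma {n} L u.

(* A monomial x^u is represented by its exponent u : 'X_{1..n}, and a set of
   monomials by a set of exponents. *)
Definition mnm_diff (n : nat) (u v : 'X_{1..n}) : 'rV[int]_n :=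
  \row_i ((u i)%:Z - (v i)%:Z).

Definition binom (k : fieldType) (n : nat) (u v : 'X_{1..n}) : {mpoly k[n]} :=
  'X_[u] - 'X_[v].
Arguments binom k {n} u v.

Definition is_binomial (k : fieldType) (n : nat) (B : {mpoly k[n]}) : Prop :=
  exists u v, u != v /\ B = binom k u v.
Arguments is_binomial k {n} B.

Definition is_ideal (k : fieldType) (n : nat) (I : set {mpoly k[n]}) : Prop :=
  I 0 /\ forall a p q, I p -> I q -> I (a * p + q).

Definition ideal_gen (k : fieldType) (n : nat) (A : set {mpoly k[n]}) :
    set {mpoly k[n]} :=
  smallest (@is_ideal k n) A.

Definition lattice_ideal (k : fieldType) (n : nat) (L : set 'rV[int]_n) :
    set {mpoly k[n]} :=
  ideal_gen [set p | exists u v, L (mnm_diff u v) /\ p = binom k u v].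
Arguments lattice_ideal k {n} L.

Definition min_gen_set (k : fieldType) (n : nat) (I S : set {mpoly k[n]}) : Prop :=
  [/\ S `<=` is_binomial k,
      ideal_gen S = I
    & forall T, T `<=` S -> ideal_gen T = I -> T = S].

Definition card_min_gen_set (k : fieldType) (n : nat) (I S : set {mpoly k[n]}) :
    Prop :=
  min_gen_set I S /\ forall T, min_gen_set I T -> (S #<= T)%card.

Definition fiber (n : nat) (L : set 'rV[int]_n) (u : 'X_{1..n}) : set 'X_{1..n} :=
  [set v | L (mnm_diff v u)].

Definition is_fiber (n : nat) (L : set 'rV[int]_n) (F : set 'X_{1..n}) : Prop :=
  exists u, F = fiber L u.

Definition fiber1 (n : nat) (L : set 'rV[int]_n) : set 'X_{1..n} :=
  fiber L 0%MM.

(* The preorder on fibers inducing the order on the equivalence classes, which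
   are handled through representatives. *)
Definition fiber_le (n : nat) (F G : set 'X_{1..n}) : Prop :=
  exists u, forall v, F v -> G (u + v)%MM.

Definition fiber_equiv (n : nat) (F G : set 'X_{1..n}) : Prop :=
  fiber_le F G /\ fiber_le G F.

Definition fiber_lt (n : nat) (F G : set 'X_{1..n}) : Prop :=
  fiber_le F G /\ ~ fiber_equiv F G.

(* [fiber_of L B F]: F is the fiber F_B of the binomial B. *)
Definition fiber_of (k : fieldType) (n : nat) (L : set 'rV[int]_n)
    (B : {mpoly k[n]}) (F : set 'X_{1..n}) : Prop :=
  exists u v, [/\ u != v, B = binom k u v, F = fiber L u & F = fiber L v].
Arguments fiber_of {k n} L B F.

Definition ideal_lt (k : fieldType) (n : nat) (L : set 'rV[int]_n)
    (F : set 'X_{1..n}) : set {mpoly k[n]} :=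
  ideal_gen [set B | lattice_ideal k L B
                     /\ exists2 G, fiber_of L B G & fiber_lt G F].
Arguments ideal_lt k {n} L F.

Definition ideal_le (k : fieldType) (n : nat) (L : set 'rV[int]_n)
    (F : set 'X_{1..n}) : set {mpoly k[n]} :=
  ideal_gen [set B | lattice_ideal k L B
                     /\ exists2 G, fiber_of L B G & fiber_le G F].
Arguments ideal_le k {n} L F.

Definition class_part (k : fieldType) (n : nat) (L : set 'rV[int]_n)
    (S : set {mpoly k[n]}) (F : set 'X_{1..n}) : set {mpoly k[n]} :=
  [set B | S B /\ exists2 G, fiber_of L B G & fiber_equiv G F].
Arguments class_part {k n} L S F.

Definition mono_ideal (k : fieldType) (n : nat) (A : set 'X_{1..n}) :
    set {mpoly k[n]} :=
  ideal_gen [set 'X_[u] | u in A].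
Arguments mono_ideal k {n} A.

Definition is_min_mono_gens (k : fieldType) (n : nat) (M : set {mpoly k[n]})
    (A : set 'X_{1..n}) : Prop :=
  mono_ideal k A = M
  /\ forall A', A' `<=` A -> mono_ideal k A' = M -> A' = A.
Arguments is_min_mono_gens {k n} M A.

(* A monomial ideal has exactly one minimal set of monomial generators, so
   this is the set G(M). *)
Definition mono_gens (k : fieldType) (n : nat) (M : set {mpoly k[n]}) :
    set 'X_{1..n} :=
  [set a | exists2 A, is_min_mono_gens M A & A a].

(* Simple graphs are given by a set V of vertices and an irreflexive symmetric
   adjacency E that only relates elements of V. *)
Definition adj (T : Type) (E : T -> T -> Prop) : rel T := fun x y => `[< E x y >].

Definition connected (T : Type) (E : T -> T -> Prop) (x y : T) : Prop :=
  exists2 p, path (adj E) x p & y = last x p.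

Definition components (T : Type) (V : set T) (E : T -> T -> Prop) : set (set T) :=
  [set V `&` connected E x | x in V].

Definition is_tree (T : eqType) (V : set T) (E : T -> T -> Prop) : Prop :=
  [/\ V !=set0,
      forall x y, V x -> V y -> connected E x y
    & forall c : seq T, (2 < size c)%N -> ~ ucycle (adj E) c].

Definition fvert (k : fieldType) (n : nat) (L : set 'rV[int]_n)
    (F : set 'X_{1..n}) : set (svec L) :=
  [set restr_sigma L u | u in mono_gens (mono_ideal k F)].
Arguments fvert k {n} L F.

Definition fedge (k : fieldType) (n : nat) (L : set 'rV[int]_n)
    (F : set 'X_{1..n}) (a b : svec L) : Prop :=
  [/\ fvert k L F a, fvert k L F b, a != b
    & exists u v, [/\ F u, F v, restr_sigma L u = a, restr_sigma L v = b
                    & ideal_lt k L F (binom k u v)]].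
Arguments fedge k {n} L F a b.

Definition gamma_vert (k : fieldType) (n : nat) (L : set 'rV[int]_n)
    (F : set 'X_{1..n}) : set (set (svec L)) :=
  components (fvert k L F) (fedge k L F).
Arguments gamma_vert k {n} L F.

(* The set of vertices of gamma is finite, so that [fset_set] does not return
   its default value. *)
Definition fiber_t (k : fieldType) (n : nat) (L : set 'rV[int]_n)
    (F : set 'X_{1..n}) : nat :=
  #|` fset_set (gamma_vert k L F)|%fset.
Arguments fiber_t k {n} L F.

Definition joins (k : fieldType) (n : nat) (L : set 'rV[int]_n)
    (F : set 'X_{1..n}) (B : {mpoly k[n]}) (C D : set (svec L)) : Prop :=
  exists u v,
    [/\ B = binom k u v,
        fiber_of L B (fiber L u) /\ fiber_equiv (fiber L u) F,
        restr_sigma L u != restr_sigma L v,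
        ideal_le k L F B /\ ~ ideal_lt k L F B
      & C (restr_sigma L u) /\ D (restr_sigma L v)].
Arguments joins {k n} L F B C D.

Definition gamma_edge (k : fieldType) (n : nat) (L : set 'rV[int]_n)
    (S : set {mpoly k[n]}) (F : set 'X_{1..n}) (C D : set (svec L)) : Prop :=
  [/\ gamma_vert k L F C, gamma_vert k L F D, C <> D
    & exists2 B, S B & joins L F B C D \/ joins L F B D C].
Arguments gamma_edge {k n} L S F C D.

(* The subgraph has all the vertices of gamma, which is a complete graph, so
   being a spanning tree means being a tree on these vertices. *)
Definition gamma_spanning_tree (k : fieldType) (n : nat) (L : set 'rV[int]_n)
    (S : set {mpoly k[n]}) (F : set 'X_{1..n}) : Prop :=
  is_tree (gamma_vert k L F) (gamma_edge L S F).
Arguments gamma_spanning_tree {k n} L S F.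

(* Main.v *)
From Stdlib Require Import Relation_Operators.
Require Import Defs.
From mathcomp Require Import all_boot all_order all_algebra finmap.
From mathcomp Require Import boolp classical_sets functions cardinality.
From mathcomp Require Import ssrcomplements mpoly.
From mathcomp Require Import zify.

Set Implicit Arguments.
Unset Strict Implicit.
Unset Printing Implicit Defensive.

Import GRing.Theory Order.TTheory.
Local Open Scope ring_scope.
Local Open Scope classical_set_scope.

(** Call two exponents congruent when their difference lies in [L]; the fibers are
    the congruence classes. A set of binomials generates the lattice ideal if and
    only if any two congruent exponents are connected by moves
    [c + a -> c + b] along the binomials [x^a - x^b] of the set
    ([ideal_gen_binomP]). The whole proof takes place in this combinatorial
    language.

    Up to congruence, the invertible monomials are those in the variables of
    sigma ([insigP]). Hence two fibers are equivalent exactly when a monomial in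
    the variables of sigma maps one into the other, the fibers equivalent to the
    fiber of 1 are those of the monomials in these variables, and the parts
    outside sigma of the monomials of a fiber form an antichain, finite by
    Dickson's lemma. A move from a strictly smaller fiber multiplies by a monomial
    with a variable outside sigma, which its two ends then share; conversely two
    monomials of a fiber sharing such a variable are related through a smaller
    fiber. So the components of the graph of a fiber class describe the relation
    generated by sharing a variable outside sigma ([linked], [ideal_ltP]), and the
    graph of a set [S] is connected exactly when any two monomials of the fiber
    are joined by a walk made of links and moves of [S] ([gamma_connectedP]).
    Induction over the fibers replaces links by moves. Therefore [S] generates if
    and only if all the graphs outside the class of the fiber of 1 are connected
    and the binomials of that class generate the ideal of the pure sublattice
    ([generates_walkP]). These conditions concern the classes separately.

    In a class other than that of the fiber of 1, a connected graph with [t]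
    vertices has at least [t - 1] edges, contains a connected subgraph with
    exactly [t - 1] edges ([spanning_subset]), and is a tree when it has [t - 1]
    edges ([gamma_tree]). So a generating set that is minimal for inclusion has
    exactly [t - 1] binomials in the class. In the class of the fiber of 1, the
    exponent differences of generators generate the pure sublattice, so there are
    at least as many generators as its rank ([rank_le_generators]). That many
    suffice ([pure_generators]): the pure sublattice has a basis containing a
    vector that is positive on sigma, which makes the variables of sigma
    invertible modulo the ideal of the binomials of the basis.

    A generating set with these optimal numbers of binomials is thus minimal for
    inclusion, and injects class by class into any other minimal generating set.
    Conversely, a minimal generating set is finite, by Dickson's lemma again
    ([min_gen_set_finite]), so if it has least cardinality then replacing its
    binomials in the class of the fiber of 1 by those of [pure_generators] shows
    that their number is the rank. *)

(** * Equivalence closures *)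

Notation rst := (@clos_refl_sym_trans _).

Lemma rst_step1 {T : Type} {R : T -> T -> Prop} {x y : T} : R x y -> rst R x y.
Proof. exact: rst_step. Qed.

Lemma rst_id {T : Type} {R : T -> T -> Prop} {x : T} : rst R x x.
Proof. exact: rst_refl. Qed.

Lemma rstC {T : Type} {R : T -> T -> Prop} {x y : T} : rst R x y -> rst R y x.
Proof. exact: rst_sym. Qed.

Lemma rstT {T : Type} {R : T -> T -> Prop} {x y z : T} :
  rst R x y -> rst R y z -> rst R x z.
Proof. exact: rst_trans. Qed.

Lemma rst_least {T : Type} {R E : T -> T -> Prop} :
  (forall x, E x x) -> (forall x y, E x y -> E y x) ->
  (forall x y z, E x y -> E y z -> E x z) ->
  (forall x y, R x y -> E x y) -> forall x y, rst R x y -> E x y.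
Proof.
by move=> Er Es Et RE x y; elim=> *; [apply: RE|apply: Er|apply: Es|apply: Et; eassumption].
Qed.

Lemma rst_bind {T T' : Type} {R : T -> T -> Prop} {R' : T' -> T' -> Prop} (f : T -> T') :
  (forall x y, R x y -> rst R' (f x) (f y)) ->
  forall x y, rst R x y -> rst R' (f x) (f y).
Proof.
move=> RR'; apply: rst_least => [x|x y|x y z|//].
- exact: rst_id.
- exact: rstC.
- exact: rstT.
Qed.

(** * Dickson's lemma *)

Lemma nondecreasing_subseq (a : nat -> nat) :
  exists g : nat -> nat, {homo g : i j / (i < j)%N}
                         /\ {homo a \o g : i j / (i <= j)%N}.
Proof.
have least N : exists m, (N <= m)%N /\ forall j, (N <= j)%N -> (a m <= a j)%N.
  have ex : exists v, `[< exists2 m, (N <= m)%N & a m = v >].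
    by exists (a N); apply/asboolP; exists N.
  case: (ex_minnP ex) => v /asboolP[m Nm am] vmin; exists m; split=> // j Nj.
  by rewrite am; apply: vmin; apply/asboolP; exists j.
have [h hP] := choice least.
pose g := fix g i := if i is i'.+1 then h (g i').+1 else h 0%N.
have gS i : (g i < g i.+1)%N by case: (hP (g i).+1).
have gmono : {homo g : i j / (i < j)%N} by apply: homo_ltn => //; apply: ltn_trans.
exists g; split=> // i j; rewrite leq_eqVlt => /predU1P[->//|ij] /=.
have gij : (g i < g j)%N by apply: gmono.
by case: i ij gij => [|i] ij gij /=; apply: (hP _).2 => //;
  apply: ltn_trans gij.
Qed.

(** Extract a nondecreasing subsequence for one coordinate after the other. *)
Lemma dickson (I : finType) (f : nat -> I -> nat) :
  exists i j, (i < j)%N /\ forall t, (f i t <= f j t)%N.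
Proof.
suff [g [gm gf]] : exists g : nat -> nat, {homo g : i j / (i < j)%N} /\
    forall t, t \in enum I -> {homo (fun i => f (g i) t) : i j / (i <= j)%N}.
  by exists (g 0%N), (g 1%N); split=> [|t]; [apply: gm|apply: gf; rewrite ?mem_enum].
elim: (enum I) => [|t s [g [gm gf]]]; first by exists id; split.
have [h [hm hf]] := nondecreasing_subseq (fun i => f (g i) t).
exists (g \o h); split=> [i j ij|t']; first by apply: gm; apply: hm.
rewrite inE => /predU1P[->//|t's] i j ij.
by apply: (gf _ t's); move: ij; rewrite leq_eqVlt => /predU1P[->//|/hm/ltnW].
Qed.

(** The form in which Dickson's lemma is used: an infinite set would contain a
    sequence without repetition, hence two comparable elements. *)
Lemma finite_antichain (J : finType) (T : Type) (A : set T) (f : T -> J -> nat) :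
  (forall x y, A x -> A y -> (forall t, (f x t <= f y t)%N) -> x = y) ->
  finite_set A.
Proof.
move=> antiA; apply: contrapT => /infiniteP/card_leP/unsquash h.
pose e i := h (SigSub (mem_set (I : [set: nat] i))).
have [i [j [ij /antiA eij]]] := dickson (fun i => f (val (e i))).
have /val_inj eq_e : val (e i) = val (e j) by apply: eij; apply: set_valP.
have /(congr1 val)/= eq_ij := 'inj_h (mem_set I) (mem_set I) eq_e.
by rewrite eq_ij ltnn in ij.
Qed.

(** * Ideals generated by binomials *)

Section Ideals.
Variables (k : fieldType) (n : nat).
Implicit Types (A I : set {mpoly k[n]}) (u v w : 'X_{1..n}).

Lemma ideal_gen_ideal A : is_ideal (ideal_gen A).
Proof.
split=> [J [[]]//|a p q Ap Aq J [Jid AJ]].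
by apply: Jid.2; [apply: Ap|apply: Aq].
Qed.

Lemma idealM I a p : is_ideal I -> I p -> I (a * p).
Proof. by case=> I0 Ilin Ip; rewrite -[a * p]addr0; apply: Ilin. Qed.

Lemma idealD I p q : is_ideal I -> I p -> I q -> I (p + q).
Proof. by case=> I0 Ilin Ip Iq; rewrite -[p]mul1r; apply: Ilin. Qed.

Lemma idealN I p : is_ideal I -> I p -> I (- p).
Proof. by move=> Iid Ip; rewrite -mulN1r; apply: idealM. Qed.

Lemma sub_ideal_gen A : A `<=` ideal_gen A.
Proof. exact: sub_gen_smallest. Qed.

Lemma ideal_gen_sub A I : is_ideal I -> A `<=` I -> ideal_gen A `<=` I.
Proof. exact: smallest_sub. Qed.

Lemma ideal_gen_mono A I : A `<=` I -> ideal_gen A `<=` ideal_gen I.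
Proof.
move=> AI; apply: ideal_gen_sub; first exact: ideal_gen_ideal.
by apply: subset_trans AI _; apply: sub_ideal_gen.
Qed.

Lemma ideal_gen_finite A p : ideal_gen A p ->
  exists A', [/\ A' `<=` A, finite_set A' & ideal_gen A' p].
Proof.
pose J := [set p | exists A', [/\ A' `<=` A, finite_set A' & ideal_gen A' p]].
suff /ideal_gen_sub sub : is_ideal J.
  apply: (sub A) => q Aq; exists [set q]; split; first by move=> _ ->.
    exact: finite_set1.
  exact: sub_ideal_gen.
split=> [|a q q' [B [BA finB Bq]] [B' [B'A finB' B'q']]].
  by exists set0; split=> //; case: (ideal_gen_ideal set0).
exists (B `|` B'); split; first by rewrite subUset.
  by rewrite finite_setU.
apply: (ideal_gen_ideal _).2.
  by apply: ideal_gen_mono Bq; apply: subsetUl.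
by apply: ideal_gen_mono B'q'; apply: subsetUr.
Qed.

Definition moves A u v : Prop :=
  exists a b c, [/\ A (binom k a b), u = (c + a)%MM & v = (c + b)%MM].

Definition conn A := rst (moves A).

Lemma binomxx u : binom k u u = 0. Proof. exact: subrr. Qed.

Lemma binomC u v : binom k v u = - binom k u v.
Proof. by rewrite /binom opprB. Qed.

Lemma binomD u v w : binom k u w = binom k u v + binom k v w.
Proof. by rewrite /binom addrA subrK. Qed.

Lemma binomM c u v : binom k (c + u) (c + v) = 'X_[c] * binom k u v.
Proof. by rewrite /binom !mpolyXD mulrBr. Qed.

Lemma binomE u v : binom k u v = (-1) *: 'X_[v] + 'X_[u].
Proof. by rewrite scaleN1r addrC. Qed.

Definition coeff_sum (c : pred 'X_{1..n}) (p : {mpoly k[n]}) : k :=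
  \sum_(m <- msupp p | c m) p@_m.

Lemma coeff_sumE c d p : (msize p <= d)%N ->
  coeff_sum c p = \sum_(m : 'X_{1..n < d} | c m) p@_m.
Proof.
move=> pd; pose I : subFinType _ := 'X_{1..n < d}.
rewrite /coeff_sum [LHS]big_mkcond [RHS]big_mkcond (big_mksub I) /=; first last.
- by move=> x /msize_mdeg_lt /leq_trans; apply.
- by rewrite msupp_uniq.
by rewrite big_rmcond //= => i /memN_msupp_eq0 ->; rewrite if_same.
Qed.

Lemma coeff_sumD c x p q :
  coeff_sum c (x *: p + q) = x * coeff_sum c p + coeff_sum c q.
Proof.
set d := maxn (msize (x *: p + q)) (maxn (msize p) (msize q)).
rewrite !(@coeff_sumE c d) /d ?leq_max ?leqnn ?orbT // mulr_sumr -big_split /=.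
by apply: eq_bigr => i _; rewrite mcoeffD mcoeffZ.
Qed.

Lemma coeff_sumX c u : coeff_sum c 'X_[u] = (c u)%:R.
Proof.
rewrite /coeff_sum msuppX big_cons big_nil; case: (c u) => //.
by rewrite mcoeffX eqxx addr0.
Qed.

(** In the ideal of a set [A] of binomials, a difference of monomials can only
    be obtained by walking from one monomial to the other: summing the
    coefficients over one class of [conn A] kills all monomial multiples of the
    generators, hence the ideal, while it separates distinct classes. *)
Lemma ideal_gen_binomP A u v : (forall B, A B -> exists a b, B = binom k a b) ->
  ideal_gen A (binom k u v) <-> conn A u v.
Proof.
move=> Abin; split=> [Auv|].
  pose cls w : pred 'X_{1..n} := fun m => `[< conn A w m >].
  pose K := [set p | forall w m, coeff_sum (cls w) ('X_[m] * p) = 0].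
  have sum0 w : coeff_sum (cls w) 0 = 0.
    by rewrite /coeff_sum msupp0 big_nil.
  have Kid : is_ideal K.
    split=> [w m|a p q Kp Kq w m]; first by rewrite mulr0.
    elim/mpolyind: a m => [|x m' a _ _ IHa] m.
      by rewrite mul0r add0r Kq.
    rewrite mulrDl -addrA mulrDr -scalerAl -scalerAr coeff_sumD IHa addr0.
    by rewrite mulrA -mpolyXD Kp mulr0.
  have AK : A `<=` K.
    move=> B AB; have [a [b eB]] := Abin _ AB; rewrite {}eB in AB * => w m.
    rewrite -binomM binomE coeff_sumD !coeff_sumX mulN1r.
    suff -> : cls w (m + b)%MM = cls w (m + a)%MM by rewrite addNr.
    have mab : conn A (m + a)%MM (m + b)%MM by apply: rst_step1; exists a, b, m.
    by apply: asbool_equiv_eq; split=> wm; [apply: rstT wm (rstC mab)|apply: rstT wm mab].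
  have := ideal_gen_sub Kid AK Auv u 0%MM.
  rewrite mpolyX0 mul1r binomE coeff_sumD !coeff_sumX mulN1r addrC.
  have -> : cls u u = true by apply/asboolP; apply: rst_id.
  by case: (boolP (cls u v)) => [/asboolP//|_ /eqP]; rewrite oppr0 addr0 oner_eq0.
have Iid := ideal_gen_ideal A.
elim=> {u v} [u v [a [b [c [Aab -> ->]]]]|u|u v _|u v w _ Iuv _ Ivw].
- by rewrite binomM; apply: (idealM _ Iid); apply: (sub_ideal_gen Aab).
- by rewrite binomxx; case: Iid.
- by rewrite (binomC u); apply: (idealN Iid).
- by rewrite (binomD u v w); apply: (idealD Iid).
Qed.

Lemma binom_inj (a b a' b' : 'X_{1..n}) : a != b -> binom k a b = binom k a' b' ->
  (a = a' /\ b = b') \/ (a = b' /\ b = a').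
Proof.
move=> ab /mpolyP eq_c.
have := eq_c a; have := eq_c b; rewrite /binom !mcoeffB !mcoeffX !eqxx.
rewrite [b == a]eq_sym (negbTE ab) subr0 sub0r.
case: (eqVneq a' a) => [->|a'a]; last first.
  case: (eqVneq b' a) => [->|]; last by rewrite subr0 => _ _ /eqP; rewrite oner_eq0.
  rewrite (negbTE ab) subr0.
  case: (eqVneq a' b) => [->|_ /eqP]; first by right.
  by rewrite oppr_eq0 oner_eq0.
rewrite (negbTE ab) sub0r.
case: (eqVneq b' b) => [->|_ /eqP]; first by left.
by rewrite oppr0 oppr_eq0 oner_eq0.
Qed.

End Ideals.

(** * Lattices and congruence of exponents *)

Section Lattice.
Variables (n : nat) (L : set 'rV[int]_n) (latL : is_lattice L).
Implicit Types (u v w a b c d : 'X_{1..n}) (x y : 'rV[int]_n).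

Lemma lattice0 : L 0. Proof. by case: latL. Qed.

Lemma latticeB x y : L x -> L y -> L (x - y).
Proof. by case: latL => _; apply. Qed.

Lemma latticeN x : L x -> L (- x).
Proof. by rewrite -sub0r; apply: latticeB; apply: lattice0. Qed.

Lemma latticeD x y : L x -> L y -> L (x + y).
Proof. by move=> Lx Ly; rewrite -[y]opprK; apply/latticeB/latticeN. Qed.

Lemma latticeZ (z : int) x : L x -> L (z *: x).
Proof.
move=> Lx; suff LMn m : L (x *+ m).
  case: z => m; rewrite ?NegzE ?scaleNr; [|apply: latticeN];
    by rewrite -[Posz _]natz scaler_nat.
elim: m => [|m IHm]; first exact: lattice0.
by rewrite mulrS; apply: latticeD.
Qed.

Lemma lattice_sum (J : Type) (s : seq J) (F : J -> 'rV[int]_n) :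
  (forall j, L (F j)) -> L (\sum_(j <- s) F j).
Proof.
move=> LF; apply: big_ind => [|x y|//]; [exact: lattice0|exact: latticeD].
Qed.

Lemma lattice_mulmx m (M : 'M[int]_(m, n)) (z : 'rV_m) :
  (forall i, L (row i M)) -> L (z *m M).
Proof. by move=> LM; rewrite mulmx_sum_row; apply: lattice_sum => j; apply: latticeZ. Qed.

Definition eqv u v : Prop := L (mnm_diff u v).

Lemma mnm_diffxx u : mnm_diff u u = 0.
Proof. by apply/rowP => i; rewrite !mxE subrr. Qed.

Lemma mnm_diffC u v : mnm_diff v u = - mnm_diff u v.
Proof. by apply/rowP => i; rewrite !mxE opprB. Qed.

Lemma mnm_diffD v u w : mnm_diff u w = mnm_diff u v + mnm_diff v w.
Proof. by apply/rowP => i; rewrite !mxE addrA subrK. Qed.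

Lemma mnm_diff_addl c u v : mnm_diff (c + u) (c + v) = mnm_diff u v.
Proof. by apply/rowP => i; rewrite !mxE !mnmDE; lia. Qed.

Lemma eqv_refl u : eqv u u.
Proof. by rewrite /eqv mnm_diffxx; apply: lattice0. Qed.

Lemma eqv_sym u v : eqv u v -> eqv v u.
Proof. by rewrite /eqv (mnm_diffC u v); apply: latticeN. Qed.

Lemma eqv_trans v u w : eqv u v -> eqv v w -> eqv u w.
Proof. by rewrite /eqv (mnm_diffD v u w); apply: latticeD. Qed.

Lemma eqv_addl c u v : eqv (c + u)%MM (c + v)%MM = eqv u v.
Proof. by rewrite /eqv mnm_diff_addl. Qed.

Lemma eqv_add a b u v : eqv a b -> eqv u v -> eqv (a + u)%MM (b + v)%MM.
Proof.
move=> ab uv; apply: (@eqv_trans (a + v)%MM); first by rewrite eqv_addl.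
by rewrite ![(_ + v)%MM]addmC eqv_addl.
Qed.

Lemma eqv_mulmn u N : eqv u 0%MM -> eqv (u *+ N)%MM 0%MM.
Proof.
move=> u0; elim: N => [|N IHN]; first by rewrite mulm0n; apply: eqv_refl.
by rewrite mulmS -[0%MM]addm0; apply: eqv_add.
Qed.

Lemma rst_eqv (R : 'X_{1..n} -> 'X_{1..n} -> Prop) :
  (forall u v, R u v -> eqv u v) -> forall u v, rst R u v -> eqv u v.
Proof.
move=> Reqv; apply: rst_least => // [u|u v|u v w].
- exact: eqv_refl.
- exact: eqv_sym.
- exact: eqv_trans.
Qed.

(** A chain of congruent exponents starting in a set [Q] that is closed under
    congruence stays in [Q], so its steps can be translated under the
    assumption that they lie in [Q]. *)
Lemma rst_bind_in (Q : 'X_{1..n} -> Prop) (T : Type)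
    (R : 'X_{1..n} -> 'X_{1..n} -> Prop) (R' : T -> T -> Prop) (h : 'X_{1..n} -> T) :
  (forall u v, eqv u v -> Q u -> Q v) -> (forall u v, R u v -> eqv u v) ->
  (forall u v, R u v -> Q u -> rst R' (h u) (h v)) ->
  forall u v, rst R u v -> Q u -> rst R' (h u) (h v).
Proof.
move=> Qeqv Reqv RR' u v; elim=> {u v} [u v|u _|u v uv IH Qv|u v w uv IHu vw IHv Qu].
- exact: RR'.
- exact: rst_id.
- by apply/rstC/IH; apply: Qeqv Qv; apply/eqv_sym/(rst_eqv Reqv).
- by apply: rstT (IHu Qu) (IHv _); apply: Qeqv Qu; apply: (rst_eqv Reqv).
Qed.

Definition pos_part x : 'X_{1..n} :=
  [multinom (if x ord0 i is Posz m then m else 0%N) | i < n].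
Definition neg_part x : 'X_{1..n} :=
  [multinom (if x ord0 i is Negz m then m.+1 else 0%N) | i < n].

Lemma mnm_diff_parts x : mnm_diff (pos_part x) (neg_part x) = x.
Proof.
apply/rowP => i; rewrite !mxE !mnmE; case: (x ord0 i) => m.
  by rewrite subr0.
by rewrite NegzE sub0r.
Qed.

Lemma mnm_diff_nneg x : (forall i, 0 <= x ord0 i) -> mnm_diff (pos_part x) 0 = x.
Proof.
move=> x0; rewrite -{2}[x]mnm_diff_parts; congr mnm_diff; apply/mnmP => i.
by rewrite !mnmE; have := x0 i; case: (x ord0 i).
Qed.

Lemma lattice_sigmaP i : lattice_sigma L i <-> exists2 c, eqv c 0%MM & (0 < c i)%N.
Proof.
split=> [[x [Lx x0] /= xi]|[c c0 ci]].
  exists (pos_part x); first by rewrite /eqv mnm_diff_nneg.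
  by rewrite mnmE; have := x0 i; move: xi; case: (x ord0 i) => // -[].
exists (mnm_diff c 0); last by rewrite /= mxE mnm0E subr0 -lt0n.
by split=> // j /=; rewrite mxE mnm0E subr0.
Qed.

Lemma sigma_full_vector : exists2 w, eqv w 0%MM &
  forall i, lattice_sigma L i <-> (0 < w i)%N.
Proof.
have /choice[c cP] i : exists c, eqv c 0%MM /\ (lattice_sigma L i -> (0 < c i)%N).
  have [/lattice_sigmaP[c c0 ci]|nsi] := pselect (lattice_sigma L i).
    by exists c.
  by exists 0%MM; split=> //; apply: eqv_refl.
pose w := (\big[+%MM/0%MM]_i c i)%MM.
have w0 : eqv w 0%MM.
  rewrite /w; apply: (big_ind (fun w => eqv w 0%MM)) => [|u v u0 v0|i _].
  - exact: eqv_refl.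
  - by rewrite -[0%MM]addm0; apply: eqv_add.
  - by case: (cP i).
exists w => // i; split=> [si|wi]; last by apply/lattice_sigmaP; exists w.
rewrite /w (bigD1 i) //= mnmDE ltn_addr //.
by apply: (cP i).2.
Qed.

(** The monomials in the variables of sigma, which are the units up to congruence
    by [insigP]. *)
Definition insig c : Prop := forall i, (0 < c i)%N -> lattice_sigma L i.

Lemma le_mdeg u i : (u i <= mdeg u)%N.
Proof. by rewrite mdegE (bigD1 i) //= leq_addr. Qed.

(** A multiple of a full vector of sigma dominates any given monomial on the
    coordinates in sigma. *)
Lemma sigma_dominant u : exists2 w, eqv w 0%MM &
  forall i, (lattice_sigma L i -> (u i <= w i)%N) /\ (~ lattice_sigma L i -> w i = 0%N).
Proof.
have [w w0 wP] := sigma_full_vector.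
exists (w *+ mdeg u)%MM; first exact: eqv_mulmn.
move=> i; rewrite mulmnE; split=> [/wP w_gt0|nsi].
  by rewrite (leq_trans (le_mdeg u i)) // leq_pmull.
by case: (posnP (w i)) => [->//|/wP].
Qed.

Lemma insigP c : insig c <-> exists d, eqv (d + c)%MM 0%MM.
Proof.
split=> [ic|[d dc] i ci]; last first.
  by apply/lattice_sigmaP; exists (d + c)%MM; rewrite // mnmDE ltn_addl.
have [w w0 wP] := sigma_dominant c; exists (w - c)%MM; rewrite submK //.
by apply/mnm_lepP => i; case: (posnP (c i)) => [->//|/ic/(wP i).1].
Qed.

Lemma insigD a b : insig (a + b)%MM <-> insig a /\ insig b.
Proof.
split=> [iab|[ia ib] i].
  by split=> i ci; apply: iab; rewrite mnmDE; lia.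
rewrite mnmDE addn_gt0 => /orP[/ia//|/ib//].
Qed.

Lemma insig_eqv u v : eqv u v -> insig u -> insig v.
Proof.
move=> uv /insigP[d du]; apply/insigP; exists d.
by apply: eqv_trans du; rewrite eqv_addl; apply: eqv_sym.
Qed.

Lemma eqv_addl_insig c u : eqv (c + u)%MM u <-> eqv c 0%MM.
Proof. by rewrite -{2}[u]addm0 [(c + u)%MM]addmC eqv_addl. Qed.

Definition sigma_eq u v := forall i, ~ lattice_sigma L i -> u i = v i.

(** The parts outside sigma of congruent monomials are incomparable: a strict
    inequality would give a nonnegative vector of the lattice with support
    outside sigma. *)
Lemma sigma_antichain u v : eqv u v ->
  (forall i, ~ lattice_sigma L i -> (u i <= v i)%N) -> sigma_eq u v.
Proof.
move=> uv le_uv; have [w w0 wP] := sigma_dominant u.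
have le_u : (u <= v + w)%MM.
  apply/mnm_lepP => i; rewrite mnmDE.
  by have [/(wP i).1|/le_uv] := pselect (lattice_sigma L i); lia.
have /insigP ic : exists d, eqv (d + (v + w - u))%MM 0%MM.
  exists 0%MM; rewrite add0m -(eqv_addl_insig _ u) submK //.
  by rewrite -[u in eqv _ u]addm0; apply: eqv_add => //; apply: eqv_sym.
move=> i nsi; apply/eqP; rewrite eqn_leq le_uv //=.
rewrite leqNgt; apply/negP => lt_uv.
by apply/nsi/ic; rewrite mnmBE mnmDE (wP i).2 // addn0 subn_gt0.
Qed.

Lemma sigma_eq_addl c u : insig c -> sigma_eq (c + u)%MM u.
Proof.
move=> ic i nsi; rewrite mnmDE; case: (posnP (c i)) => [->//|/ic//].
Qed.

Lemma restr_sigmaP u v : restr_sigma L u = restr_sigma L v <-> sigma_eq u v.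
Proof.
split=> [/ffunP uv i nsi|uv].
  have nsi' : i \notin lattice_sigma L by apply/negP; rewrite inE.
  by have := uv (exist _ i nsi'); rewrite !ffunE.
apply/ffunP => -[i /= nsi]; rewrite !ffunE /=; apply: uv => si.
by rewrite mem_set in nsi.
Qed.

Lemma lattice_pureP x :
  lattice_pure L x <-> L x /\ forall i, x ord0 i != 0 -> lattice_sigma L i.
Proof.
split.
  pose P := [set x : 'rV[int]_n | L x /\ forall i, x ord0 i != 0 -> lattice_sigma L i].
  suff : lattice_pure L `<=` P by apply.
  apply: smallest_sub; last first.
    by move=> y Ly; split=> [|i yi]; [case: Ly|exists y].
  split; first by split=> [|i]; [apply: lattice0|rewrite mxE eqxx].
  move=> y z [Ly sy] [Lz sz]; split=> [|i]; first exact: latticeB.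
  rewrite !mxE; case: (eqVneq (y ord0 i) 0) => [->|/sy//].
  by rewrite sub0r oppr_eq0 => /sz.
move=> [Lx sx] D [[D0 DB] LD].
have [w w0 wP] := sigma_dominant (neg_part x).
have Lw : L (mnm_diff w 0) by [].
have -> : x = (x + mnm_diff w 0) - mnm_diff w 0 by rewrite addrK.
apply: DB; apply: LD; split=> //; last first.
- by move=> i; rewrite !mxE mnm0E subr0.
- move=> i; rewrite !mxE mnm0E subr0.
  case: (eqVneq (x ord0 i) 0) => [->//|/sx/(wP i).1].
  by rewrite mnmE; case: (x ord0 i); lia.
by apply: latticeD.
Qed.

Lemma lattice_pure_lattice : is_lattice (lattice_pure L).
Proof.
by split=> [D [[]]//|x y Px Py D D1]; apply: D1.1.2; [apply: Px|apply: Py].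
Qed.

(** * Fibers *)

Lemma fiberP u v : fiber L u = fiber L v <-> eqv u v.
Proof.
split=> [Fuv|uv].
  by have : fiber L u u by [apply: eqv_refl]; rewrite Fuv.
apply/seteqP; split=> w wu.
  exact: eqv_trans wu uv.
exact: eqv_trans wu (eqv_sym uv).
Qed.

Lemma fiber_leP u v : fiber_le (fiber L u) (fiber L v) <-> exists a, eqv (a + u)%MM v.
Proof.
split=> [[a Fuv]|[a auv]]; exists a; first by apply: Fuv; apply: eqv_refl.
by move=> w wu; apply: eqv_trans auv; rewrite eqv_addl.
Qed.

Lemma fiber_equivP u v : fiber_equiv (fiber L u) (fiber L v) <->
  exists2 a, insig a & eqv (a + u)%MM v.
Proof.
split=> [[/fiber_leP[a au] /fiber_leP[b bv]]|[a /insigP[d da] au]].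
  exists a => //; apply/insigP; exists b; apply/(eqv_addl_insig _ u).
  by apply: eqv_trans bv; rewrite -addmA eqv_addl.
split; apply/fiber_leP; first by exists a.
exists d; apply: (@eqv_trans (d + (a + u))%MM).
  by rewrite eqv_addl; apply: eqv_sym.
by rewrite addmA; apply/eqv_addl_insig.
Qed.

Lemma fiber_equiv1P u : fiber_equiv (fiber L u) (fiber1 L) <-> insig u.
Proof.
split=> [[/fiber_leP[d dc] _]|/insigP iu]; first by apply/insigP; exists d.
by split; apply/fiber_leP => //; exists u; rewrite addm0; apply: eqv_refl.
Qed.

Lemma fiber_le_trans (F G H : set 'X_{1..n}) :
  fiber_le F G -> fiber_le G H -> fiber_le F H.
Proof.
by move=> [a FG] [b GH]; exists (b + a)%MM => w /FG/GH; rewrite addmA.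
Qed.

Lemma fiber_equiv_refl (F : set 'X_{1..n}) : fiber_equiv F F.
Proof. by split; exists 0%MM => w; rewrite add0m. Qed.

Lemma fiber_equiv_sym (F G : set 'X_{1..n}) : fiber_equiv F G -> fiber_equiv G F.
Proof. by case. Qed.

Lemma fiber_equiv_trans (G F H : set 'X_{1..n}) :
  fiber_equiv F G -> fiber_equiv G H -> fiber_equiv F H.
Proof.
by move=> [FG GF] [GH HG]; split; [apply: fiber_le_trans FG GH|apply: fiber_le_trans HG GF].
Qed.

Lemma fiber_lt_equiv (F G H : set 'X_{1..n}) :
  fiber_equiv G H -> fiber_lt F G -> fiber_lt F H.
Proof.
move=> GH [FG nFG]; split; first by apply: fiber_le_trans FG _; case: GH.
by move=> FH; apply: nFG; apply: fiber_equiv_trans FH (fiber_equiv_sym GH).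
Qed.

Lemma fiber_lt_addl c u : fiber_lt (fiber L u) (fiber L (c + u)%MM) <-> ~ insig c.
Proof.
have Fle : fiber_le (fiber L u) (fiber L (c + u)%MM).
  by apply/fiber_leP; exists c; apply: eqv_refl.
split=> [[_ nequ] ic|nic].
  by apply: nequ; apply/fiber_equivP; exists c => //; apply: eqv_refl.
split=> // -[_ /fiber_leP[d]]; rewrite addmA => /eqv_addl_insig dc.
by apply: nic; apply/insigP; exists d.
Qed.

Lemma fiber_equiv_addl c u : fiber_equiv (fiber L u) (fiber L (c + u)%MM) <-> insig c.
Proof.
split=> [equ|ic]; last by apply/fiber_equivP; exists c => //; apply: eqv_refl.
by apply: contrapT => /(fiber_lt_addl c u)[].
Qed.

End Lattice.

(** * Monomial ideals *)

Section MonomialIdeals.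
Variables (k : fieldType) (n : nat).
Implicit Types (A F : set 'X_{1..n}) (u v a : 'X_{1..n}).

Lemma mono_idealP A u : mono_ideal k A 'X_[u] <-> exists2 a, A a & (a <= u)%MM.
Proof.
split=> [Au|[a Aa au]]; last first.
  rewrite -(submK au) mpolyXD; apply: (idealM _ (ideal_gen_ideal _)).
  by apply: sub_ideal_gen; exists a.
pose J := [set p : {mpoly k[n]} |
  forall m, m \in msupp p -> exists2 a, A a & (a <= m)%MM].
suff /ideal_gen_sub sub : is_ideal J.
  apply: (sub [set 'X_[a] | a in A]) Au _ _ => [_ [a Aa <-] m|].
    by rewrite msuppX inE => /eqP ->; exists a => //; apply: lepm_refl.
  by rewrite msuppX inE.
split=> [m|b p q Jp Jq m]; first by rewrite msupp0.
move=> /msuppD_le; rewrite mem_cat => /orP[/msuppM_le|/Jq//].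
case/allpairsP => -[x y] [/= _ /Jp[a Aa ay] ->]; exists a => //.
by apply: lepm_trans ay _; apply: lem_addl.
Qed.

Lemma mono_ideal_mono A F : A `<=` F -> mono_ideal k A `<=` mono_ideal k F.
Proof. by move=> AF; apply: ideal_gen_mono => _ [a /AF Fa <-]; exists a. Qed.

Definition min_elements F := [set a | F a /\ forall b, F b -> (b <= a)%MM -> b = a].

Lemma min_elements_below F u : F u -> exists2 a, min_elements F a & (a <= u)%MM.
Proof.
have [N le_uN] := ubnP (mdeg u); elim: N u le_uN => // N IHN u le_uN Fu.
have [min_u|] := pselect (min_elements F u); first by exists u => //; apply: lepm_refl.
move=> /not_andP[//|/existsNP[b /not_implyP[Fb /not_implyP[bu /eqP nbu]]]].
have [||a Aa ab] := IHN b; [|by []|by exists a => //; apply: lepm_trans bu].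
rewrite (leq_trans _ (le_uN : (mdeg u <= N)%N)) // -(submK bu) mdegD -[X in (X < _)%N]add0n.
rewrite ltn_add2r lt0n mdeg_eq0; apply: contra nbu => /eqP ub0.
by rewrite -(submK bu) ub0 add0m.
Qed.

Lemma mono_gens_min F : mono_gens (mono_ideal k F) = min_elements F.
Proof.
have minF : mono_ideal k (min_elements F) = mono_ideal k F.
  apply/seteqP; split; first by apply: mono_ideal_mono => a [].
  apply: ideal_gen_sub; first exact: ideal_gen_ideal.
  by move=> _ [u Fu <-]; apply/mono_idealP; apply: min_elements_below.
have sub_min A : mono_ideal k A = mono_ideal k F -> min_elements F `<=` A.
  move=> AF a [Fa mina].
  have /mono_idealP[b Ab ba] : mono_ideal k A 'X_[a].
    by rewrite AF; apply/mono_idealP; exists a => //; apply: lepm_refl.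
  have /mono_idealP[c Fc cb] : mono_ideal k F 'X_[b].
    by rewrite -AF; apply/mono_idealP; exists b => //; apply: lepm_refl.
  have ca := mina c Fc (lepm_trans cb ba); rewrite {}ca in cb.
  suff -> : a = b by [].
  by apply/mnmP => i; apply/eqP; rewrite eqn_leq (mnm_lepP ba) (mnm_lepP cb).
apply/seteqP; split=> [a [A [AF minA] Aa]|a mina].
  by rewrite (minA _ (sub_min A AF) minF).
exists (min_elements F) => //; split=> // A' A'min A'F.
by apply/seteqP; split=> // b; apply: sub_min.
Qed.

End MonomialIdeals.

(** * Linked monomials of a fiber *)

Section Linked.
Variables (k : fieldType) (n : nat) (L : set 'rV[int]_n) (latL : is_lattice L).
Implicit Types (u v w a b c : 'X_{1..n}) (F G : set 'X_{1..n}).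
Implicit Types (S T : set {mpoly k[n]}).

Lemma lattice_ideal_ideal : is_ideal (lattice_ideal k L).
Proof. exact: ideal_gen_ideal. Qed.

Lemma conn_eqv T u v :
  (forall a b, T (binom k a b) -> eqv L a b) -> conn T u v -> eqv L u v.
Proof.
move=> Teqv; apply: (rst_eqv latL) => _ _ [a [b [c [Tab -> ->]]]].
by rewrite eqv_addl; apply: Teqv.
Qed.

Lemma lattice_idealP u v : lattice_ideal k L (binom k u v) <-> eqv L u v.
Proof.
split=> [|uv]; last by apply: sub_ideal_gen; exists u, v.
move=> /ideal_gen_binomP uv; apply: conn_eqv (uv _) => [a b [a' [b' [ab' eq_ab]]]|].
  have [<-|/eqP nab] := pselect (a = b); first exact: eqv_refl.
  by case: (binom_inj nab eq_ab) => -[-> ->] //; apply: eqv_sym.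
by move=> B [a [b [_ ->]]]; exists a, b.
Qed.

Lemma fiber_ofP u v F : u != v ->
  fiber_of L (binom k u v) F <-> eqv L u v /\ F = fiber L u.
Proof.
move=> uv; split=> [[a [b [_ /(binom_inj uv) eq_ab Fa Fb]]]|[euv ->]].
  have eab : eqv L a b by apply/(fiberP latL); rewrite -Fa.
  by case: eq_ab => -[-> ->] //; split=> //; apply: eqv_sym.
by exists u, v; split=> //; apply/(fiberP latL).
Qed.

Lemma class_part_binom S F u v : u != v -> class_part L S F (binom k u v) <->
  [/\ S (binom k u v), eqv L u v & fiber_equiv (fiber L u) F].
Proof.
move=> uv; split=> [[Suv [G /(fiber_ofP _ uv)[euv ->]]]|[Suv euv uF]] //.
by split=> //; exists (fiber L u) => //; apply/fiber_ofP.
Qed.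

Lemma class_partP S F B : class_part L S F B ->
  exists u v, [/\ u != v, B = binom k u v, S B, eqv L u v & fiber_equiv (fiber L u) F].
Proof.
move=> [SB [G Gof GF]]; have [u [v [uv eB _ _]]] := Gof.
rewrite eB in SB Gof *; exists u, v; have [euv Gu] := (fiber_ofP G uv).1 Gof.
by rewrite Gu in GF.
Qed.

Lemma class_part_equiv S F G : fiber_equiv F G -> class_part L S F = class_part L S G.
Proof.
move=> FG; apply/seteqP; split=> B [SB [H BH HF]]; split=> //; exists H => //.
  exact: fiber_equiv_trans FG.
by apply: fiber_equiv_trans HF (fiber_equiv_sym FG).
Qed.

Lemma class_part_self S u v : u != v -> eqv L u v -> S (binom k u v) ->
  class_part L S (fiber L u) (binom k u v).
Proof.
by move=> uv euv Suv; apply/class_part_binom => //; split=> //; apply: fiber_equiv_refl.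
Qed.

(** Two monomials of one fiber with a common variable [x_i] outside sigma differ
    by [x_i] times a binomial of a strictly smaller fiber, since [x_i] is not
    invertible up to congruence. *)
Definition linkstep u v : Prop :=
  eqv L u v /\ exists i, [/\ ~ lattice_sigma L i, (0 < u i)%N & (0 < v i)%N].

Definition linked := rst linkstep.

Lemma linkstep_addl c u v : linkstep u v -> linkstep (c + u)%MM (c + v)%MM.
Proof.
move=> [uv [i [nsi ui vi]]]; split; first by rewrite eqv_addl.
by exists i; rewrite !mnmDE !ltn_addl.
Qed.

Lemma linked_addl c u v : linked u v -> linked (c + u)%MM (c + v)%MM.
Proof.
move: u v; apply: (@rst_bind _ _ linkstep linkstep (fun w => (c + w)%MM)) => x y xy.
exact/rst_step1/linkstep_addl.
Qed.

Lemma not_insigP u : ~ insig L u <-> exists2 i, ~ lattice_sigma L i & (0 < u i)%N.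
Proof.
split=> [|[i nsi ui] iu]; last exact: nsi (iu i ui).
by move=> /existsNP[i /not_implyP[ui nsi]]; exists i.
Qed.

Lemma linked_addr c u v : ~ insig L c -> eqv L u v -> linked (c + u)%MM (c + v)%MM.
Proof.
move=> /not_insigP[i nsi ci] uv; apply: rst_step1; split; first by rewrite eqv_addl.
by exists i; rewrite !mnmDE !ltn_addr.
Qed.

Lemma linked_sigma_eq u v : eqv L u v -> sigma_eq L u v -> ~ insig L u -> linked u v.
Proof.
move=> uv suv /not_insigP[i nsi ui]; apply: rst_step1; split=> //.
by exists i; rewrite -(suv i nsi).
Qed.

Lemma linkstep_split u v : linkstep u v -> exists c a b,
  [/\ ~ insig L c, eqv L a b, u = (c + a)%MM & v = (c + b)%MM].
Proof.
move=> [uv [i [nsi ui vi]]]; exists U_(i)%MM, (u - U_(i))%MM, (v - U_(i))%MM.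
have dec (w : 'X_{1..n}) : (0 < w i)%N -> (U_(i) + (w - U_(i)) = w)%MM.
  by move=> wi; rewrite addmC submK // lep1mP -lt0n.
split; rewrite ?dec //; last by rewrite -(eqv_addl L U_(i)) !dec.
by move=> iU; apply/nsi/iU; rewrite mnm1E eqxx.
Qed.

(** A binomial of a strictly smaller fiber enters the fiber after multiplication
    by a monomial that is not invertible up to congruence; this monomial has a
    variable outside sigma, which the two terms then share. *)
Lemma ideal_ltP F u v : eqv L u v -> fiber_equiv (fiber L u) F ->
  ideal_lt k L F (binom k u v) <-> linked u v.
Proof.
move=> uv uF; rewrite /ideal_lt ideal_gen_binomP; last first.
  by move=> B [_ [G [a [b [_ -> _ _]] _]]]; exists a, b.
have Qeqv x y : eqv L x y -> fiber_equiv (fiber L x) F -> fiber_equiv (fiber L y) F.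
  by move=> /(fiberP latL) ->.
set A := [set B | _]; split=> uv_chain; move: u v uv_chain {uv} uF.
  apply: (rst_bind_in latL (R' := linkstep) (h := id) Qeqv) => [x y|].
    by move=> [a [b [c [[/lattice_idealP ab _] -> ->]]]]; rewrite eqv_addl.
  move=> _ _ [a [b [c [[/lattice_idealP ab [G Gof GF]] -> ->]]]].
  have [<- _|/eqP nab] := pselect (a = b); first exact: rst_id.
  have [_ Ga] := (fiber_ofP _ nab).1 Gof.
  move=> cF; apply: linked_addr => //; apply/(fiber_lt_addl latL c a).
  by rewrite -Ga; apply: fiber_lt_equiv (fiber_equiv_sym cF) GF.
apply: (rst_bind_in latL (R' := moves A) (h := id) Qeqv) => [x y []//|x y lxy xF].
have [<-|/eqP nxy] := pselect (x = y); first exact: rst_id.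
have [c [a [b [nic ab ex ey]]]] := linkstep_split lxy.
have nab : a != b by apply: contra nxy => /eqP ab0; rewrite ex ey ab0.
apply: rst_step1; exists a, b, c; split=> //; split; first exact/lattice_idealP.
exists (fiber L a); first by apply/fiber_ofP.
by apply: fiber_lt_equiv xF _; rewrite ex; apply/fiber_lt_addl.
Qed.

Definition walk_step T u v : Prop := linkstep u v \/ moves T u v.

(** Two monomials of a fiber are joined by a walk exactly when their components
    are connected in the graph of [T], see [gamma_connectedP]. *)
Definition walk T := rst (walk_step T).

Lemma linked_walk T u v : linked u v -> walk T u v.
Proof.
by move: u v; apply: (@rst_bind _ _ linkstep (walk_step T) id) => x y xy; apply: rst_step1; left.
Qed.

Lemma conn_walk T u v : conn T u v -> walk T u v.
Proof.
move: u v; apply: (@rst_bind _ _ (moves T) (walk_step T) id) => x y xy.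
by apply: rst_step1; right.
Qed.

Lemma walk_addl T c u v : walk T u v -> walk T (c + u)%MM (c + v)%MM.
Proof.
move: u v; apply: (@rst_bind _ _ (walk_step T) (walk_step T) (fun w => (c + w)%MM)).
move=> x y [xy|[a [b [d [Tab -> ->]]]]].
  by apply: rst_step1; left; apply: linkstep_addl.
by apply: rst_step1; right; exists a, b, (c + d)%MM; rewrite -!addmA.
Qed.

Lemma sub_lattice_eqv T a b : T `<=` lattice_ideal k L -> T (binom k a b) -> eqv L a b.
Proof. by move=> TI /TI /lattice_idealP. Qed.

Lemma walk_step_eqv T u v : T `<=` lattice_ideal k L -> walk_step T u v -> eqv L u v.
Proof.
move=> TI [[]//|[a [b [c [Tab -> ->]]]]]; rewrite eqv_addl.
exact: sub_lattice_eqv Tab.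
Qed.

(** Only the moves of the class of the fiber matter in a walk: a move from a
    strictly smaller fiber can be replaced by a link. *)
Lemma walk_class T T' F u v : T `<=` lattice_ideal k L ->
  class_part L T F `<=` T' -> fiber_equiv (fiber L u) F -> walk T u v -> walk T' u v.
Proof.
move=> TI TT' uF uv; move: u v uv uF.
apply: (rst_bind_in latL (R' := walk_step T') (h := id)) => [x y|x y|x y].
- by move=> /(fiberP latL) ->.
- exact: walk_step_eqv.
case=> [xy _|[a [b [c [Tab -> ->]]]] cF]; first by apply: rst_step1; left.
have ab := sub_lattice_eqv TI Tab.
have [<-|/eqP nab] := pselect (a = b); first exact: rst_id.
have [ic|nic] := pselect (insig L c); last exact/linked_walk/linked_addr.
apply: rst_step1; right; exists a, b, c; split=> //; apply: TT'.
apply/class_part_binom => //; split=> //; apply: fiber_equiv_trans cF.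
exact/fiber_equiv_addl.
Qed.

End Linked.

(** * Connected graphs *)

Lemma connected_rst (T : Type) (E : T -> T -> Prop) x y :
  (forall a b, E a b -> E b a) -> connected E x y <-> rst E x y.
Proof.
move=> symE; split=> [[p + ->]|].
  elim: p x => [|z p IHp] x /=; first by move=> _; apply: rst_id.
  by move=> /andP[/asboolP xz /IHp]; apply: rstT; apply: rst_step1.
pose C a b := connected E a b /\ connected E b a.
have trans a b c : connected E a b -> connected E b c -> connected E a c.
  move=> [p ap ->] [q bq ->]; exists (p ++ q); last by rewrite last_cat.
  by rewrite cat_path ap.
have step a b : E a b -> connected E a b.
  by move=> ab; exists [:: b] => //=; rewrite andbT; apply/asboolP.
suff sub : forall a b, rst E a b -> C a b by move=> /sub[].
apply: rst_least => [a|a b []//|a b c [ab ba] [bc cb]|a b ab].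
- by split; exists [::].
- by split; [apply: trans ab bc|apply: trans cb ba].
- by split; apply: step => //; apply: symE.
Qed.

(** Kruskal's algorithm: [f] labels the vertices by the components of the
    selected edges [s']; each selected edge merges two labels, so the number of
    selected edges plus the number of components is the number of vertices. *)
Lemma spanning_subseq (V : choiceType) (E : eqType) (A : {fset V}) (p q : E -> V)
    (s : seq E) : (forall e, e \in s -> p e \in A /\ q e \in A) ->
  exists (f : V -> V) (s' : seq E),
    [/\ subseq s' s, (size s' + #|` [fset f x | x in A]%fset| = #|` A|)%N,
        forall x y, f x = f y ->
          rst (fun a b => exists2 e, e \in s' & a = p e /\ b = q e) x y
      & forall e, e \in s -> f (p e) = f (q e)].
Proof.
elim: s => [|e s IHs] sA.
  exists id, [::]; split=> // [|x y ->]; last exact: rst_id.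
  by rewrite add0n; congr #|` _|; apply/fsetP => x; apply/imfsetP/idP => [[y ? ->//]|?]; exists x.
have [|f [s' [ss' sz fP fs]]] := IHs; first by move=> d ds; apply: sA; rewrite inE ds orbT.
have [pA qA] := sA e (mem_head _ _).
have [fe|/eqP fe] := pselect (f (p e) = f (q e)).
  exists f, s'; split=> // [|d]; first exact: subseq_trans ss' (subseq_cons _ _).
  by rewrite inE => /predU1P[->//|/fs].
pose g x := if f x == f (q e) then f (p e) else f x.
exists g, (e :: s'); split=> //=; first by rewrite eqxx.
- have -> : [fset g x | x in A]%fset = ([fset f x | x in A] `\ f (q e))%fset.
    apply/fsetP => y; rewrite in_fsetD1; apply/imfsetP/andP => /= [[x xA ->]|].
      rewrite /g; case: ifP => [_|->]; split=> //; last by apply/imfsetP; exists x.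
      by apply/imfsetP; exists (p e).
    move=> [yq /imfsetP[/= x xA yE]]; exists x => //.
    by rewrite /g -yE (negbTE yq).
  have fq : f (q e) \in [fset f x | x in A]%fset by apply/imfsetP; exists (q e).
  by rewrite -sz [in RHS](cardfsD1 (f (q e))) fq; lia.
- have sub x y : f x = f y ->
      rst (fun a b => exists2 e0, e0 \in e :: s' & a = p e0 /\ b = q e0) x y.
    move=> /fP; move: x y; apply: (@rst_bind _ _ _ _ id) => x y [d ds de].
    by apply: rst_step1; exists d => //; rewrite inE ds orbT.
  have pq : rst (fun a b => exists2 e0, e0 \in e :: s' & a = p e0 /\ b = q e0) (p e) (q e).
    by apply: rst_step1; exists e => //; apply: mem_head.
  move=> x y; rewrite /g; case: eqP => xq; case: eqP => yq.
  + by move=> _; apply: sub; rewrite xq yq.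
  + by move=> py; apply: rstT (sub _ _ xq) (rstT (rstC pq) (sub _ _ py)).
  + by move=> xp; apply: rstT (sub _ _ xp) (rstT pq (sub _ _ (esym yq))).
  + exact: sub.
- move=> d; rewrite inE => /predU1P[->|/fs fd]; rewrite /g ?fd //.
  by rewrite eqxx (negbTE fe).
Qed.

(** * The graph of a fiber class *)

Section Gamma.
Variables (k : fieldType) (n : nat) (L : set 'rV[int]_n) (latL : is_lattice L).
Implicit Types (u v w a b c : 'X_{1..n}) (F G : set 'X_{1..n}).
Implicit Types (S T : set {mpoly k[n]}) (C D : set (svec L)).

(** As the parts outside sigma form an antichain, passing to the minimal
    generators loses none of them. *)
Lemma fvertE f : fvert k L (fiber L f) = restr_sigma L @` fiber L f.
Proof.
rewrite /fvert mono_gens_min; apply/seteqP; split=> x [u Fu <-].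
  by case: Fu => Fu _; exists u.
have [a [Fa mina] au] := min_elements_below Fu.
exists a => //; apply/restr_sigmaP; apply: sigma_antichain => // [|i _].
  exact: (eqv_trans latL Fa) (eqv_sym latL Fu).
exact: (mnm_lepP au).
Qed.

Lemma fvert_finite f : finite_set (fvert k L (fiber L f)).
Proof.
apply: (@finite_antichain _ _ _ (fun (x : svec L) i => x i)) => x y.
rewrite fvertE => -[u Fu <-] [v Fv <-] uv.
apply/restr_sigmaP; apply: sigma_antichain => // [|i nsi].
  exact: (eqv_trans latL Fu) (eqv_sym latL Fv).
have nsi' : i \notin lattice_sigma L by apply/negP; rewrite inE.
by have := uv (exist _ i nsi'); rewrite !ffunE.
Qed.

Lemma fedge_sym F x y : fedge k L F x y -> fedge k L F y x.
Proof.
move=> [Fx Fy xy [u [v [Fu Fv ux vy uv]]]]; split=> //; first by rewrite eq_sym.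
exists v, u; split=> //; rewrite (binomC _ u v).
by apply: (idealN (ideal_gen_ideal _)).
Qed.

Definition component F x : set (svec L) := fvert k L F `&` connected (fedge k L F) x.

Lemma component_eq F x y : connected (fedge k L F) x y -> component F x = component F y.
Proof.
have E z t : connected (fedge k L F) z t <-> rst (fedge k L F) z t.
  by apply: connected_rst => a b; apply: fedge_sym.
move=> /E xy; apply/seteqP; split=> z [Fz /E xz]; split=> //; apply/E.
  exact: rstT (rstC xy) xz.
exact: rstT xy xz.
Qed.

Lemma mem_component F x : fvert k L F x -> component F x x.
Proof. by move=> Fx; split=> //; exists [::]. Qed.

Lemma gamma_vert_mem F C x : gamma_vert k L F C -> C x -> C = component F x.
Proof. by move=> [y Fy <-] [_ yx]; apply: component_eq. Qed.

Lemma gamma_vert_finite f : finite_set (gamma_vert k L (fiber L f)).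
Proof. by apply: finite_image; apply: fvert_finite. Qed.

Section Fiber.
Variable f : 'X_{1..n}.
Local Notation F := (fiber L f).
Local Notation cls u := (component F (restr_sigma L u)).

Lemma fvert_restr u : F u -> fvert k L F (restr_sigma L u).
Proof. by move=> Fu; rewrite fvertE; exists u. Qed.

Lemma eqv_fiber u v : F u -> F v -> eqv L u v.
Proof. by move=> Fu Fv; apply: (eqv_trans latL Fu) (eqv_sym latL Fv). Qed.

Lemma fiber_eqv u v : F u -> eqv L u v -> F v.
Proof. by move=> Fu uv; apply: (eqv_trans latL (eqv_sym latL uv) Fu). Qed.

Lemma fiber_equiv_mem u : F u -> fiber_equiv (fiber L u) F.
Proof. by move=> /(fiberP latL) ->; apply: fiber_equiv_refl. Qed.

Lemma gamma_vertP C : gamma_vert k L F C <-> exists2 u, F u & C = cls u.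
Proof.
split=> [[x + <-]|[u Fu ->]]; first by rewrite {1}fvertE => -[u Fu <-]; exists u.
by exists (restr_sigma L u) => //; apply: fvert_restr.
Qed.

Lemma class_lift u : fiber_equiv (fiber L u) F -> exists c, insig L c /\ F (c + u)%MM.
Proof. by move=> /(fiber_equivP latL)[c ic cu]; exists c. Qed.

Lemma restr_addl c u : insig L c -> restr_sigma L (c + u)%MM = restr_sigma L u.
Proof. by move=> ic; apply/restr_sigmaP; apply: sigma_eq_addl. Qed.

(** In the class of the fiber of 1 all the monomials have the trivial part
    outside sigma, so the graph has a single vertex. *)
Lemma gamma_vert_insig C D : insig L f ->
  gamma_vert k L F C -> gamma_vert k L F D -> C = D.
Proof.
move=> iF /gamma_vertP[u Fu ->] /gamma_vertP[v Fv ->]; congr component.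
apply/restr_sigmaP => i nsi.
have zero w : F w -> w i = 0%N.
  move=> Fw; have iw : insig L w := insig_eqv latL (eqv_sym latL Fw) iF.
  by case: (posnP (w i)) => // /iw.
by rewrite !zero.
Qed.

Hypothesis nF : ~ insig L f.

Lemma fiber_not_insig u : F u -> ~ insig L u.
Proof. by move=> Fu /(insig_eqv latL Fu). Qed.

Lemma connected_linked u v : F u -> F v ->
  connected (fedge k L F) (restr_sigma L u) (restr_sigma L v) <-> linked L u v.
Proof.
have linkF a b : F a -> F b -> restr_sigma L a = restr_sigma L b -> linked L a b.
  move=> Fa Fb /restr_sigmaP ab; apply: linked_sigma_eq ab _ => //.
    exact: eqv_fiber.
  exact: fiber_not_insig.
rewrite connected_rst => [|a b]; last exact: fedge_sym.
move=> Fu Fv; split.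
  pose E x y := (fvert k L F x <-> fvert k L F y) /\ forall a b, F a -> F b ->
    restr_sigma L a = x -> restr_sigma L b = y -> linked L a b.
  suff sub : forall x y, rst (fedge k L F) x y -> E x y.
    by move=> /sub[_]; apply.
  apply: rst_least => [x|x y [xy lxy]|x y z [xy lxy] [yz lyz]|x y].
  - by split=> // a b Fa Fb ax bx; apply: linkF => //; rewrite ax bx.
  - by split=> [|a b Fa Fb ay bx]; [apply: iff_sym|apply: rstC; apply: lxy].
  - split=> [|a b Fa Fb ax bz]; first exact: iff_trans yz.
    have : fvert k L F y by apply/xy; rewrite -ax; apply: fvert_restr.
    by rewrite fvertE => -[c Fc cy]; apply: rstT (lxy a c _ _ _ _) (lyz c b _ _ _ _).
  move=> [Fx Fy _ [a' [b' [Fa' Fb' a'x b'y /(ideal_ltP _ latL)]]]] lab.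
  split=> // a b Fa Fb ax bye.
  have la : linked L a a' by apply: linkF => //; rewrite ax a'x.
  have lb : linked L b' b by apply: linkF => //; rewrite bye b'y.
  apply: rstT la (rstT (lab _ _) lb); first exact: eqv_fiber.
  exact: fiber_equiv_mem.
move=> uv; move: u v uv Fu {Fv}.
apply: (rst_bind_in latL (R' := fedge k L F) (h := restr_sigma L))
  => [a b ab Fa|a b []//|a b lab Fa].
  exact: fiber_eqv Fa ab.
have ab : eqv L a b by case: lab.
have Fb := fiber_eqv Fa ab.
have [->|/eqP nab] := pselect (restr_sigma L a = restr_sigma L b); first exact: rst_id.
apply: rst_step1; split=> //; try exact: fvert_restr.
exists a, b; split=> //; apply/(ideal_ltP _ latL) => //; first exact: fiber_equiv_mem.
exact: rst_step1.
Qed.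

Lemma cls_eqP u v : F u -> F v -> cls u = cls v <-> linked L u v.
Proof.
move=> Fu Fv; rewrite -connected_linked //; split=> [eq_uv|]; last exact: component_eq.
have : cls u (restr_sigma L v) by rewrite eq_uv; apply/mem_component/fvert_restr.
by case.
Qed.

Lemma gamma_edgeP S C D : S `<=` lattice_ideal k L ->
  gamma_edge L S F C D <-> C <> D /\ exists a b,
    [/\ a != b, S (binom k a b), fiber_equiv (fiber L a) F &
        (C = cls a /\ D = cls b) \/ (C = cls b /\ D = cls a)].
Proof.
move=> SI; split.
  move=> [VC VD CD [B SB H]]; split=> //.
  by case: H => -[u [v [eB [_ uF] uv _ [Cu Dv]]]]; rewrite eB in SB; exists u, v;
    (split=> //; first by apply: contra_neq uv => ->); [left|right];
    split; apply: gamma_vert_mem.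
move=> [CD [a [b [nab Sab aF CDab]]]].
have ab : eqv L a b by apply: sub_lattice_eqv Sab.
have [c [ic Fca]] := class_lift aF.
have Fcb : F (c + b)%MM by apply: fiber_eqv Fca _; rewrite eqv_addl.
have VA : gamma_vert k L F (cls a).
  by apply/gamma_vertP; exists (c + a)%MM; rewrite // restr_addl.
have VB : gamma_vert k L F (cls b).
  by apply/gamma_vertP; exists (c + b)%MM; rewrite // restr_addl.
have nAB : cls a <> cls b by case: CDab CD => -[-> ->] // CD /esym.
have J : joins L F (binom k a b) (cls a) (cls b).
  exists a, b; split=> //.
  - by split=> //; apply/fiber_ofP.
  - by apply/eqP => eab; apply: nAB; rewrite eab.
  - split.
      apply: sub_ideal_gen; split; first exact/lattice_idealP.
      by exists (fiber L a); [apply/fiber_ofP|case: aF].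
    move=> /(ideal_ltP _ latL ab aF) lab; apply: nAB.
    have /cls_eqP := linked_addl c lab.
    by rewrite !restr_addl //; apply.
  - by rewrite -(restr_addl a ic) -(restr_addl b ic); split; apply/mem_component/fvert_restr.
case: CDab CD => -[-> ->] CD; split=> //; exists (binom k a b) => //; first by left.
by right.
Qed.

Lemma gamma_edge_sym S C D : gamma_edge L S F C D -> gamma_edge L S F D C.
Proof.
by move=> [VC VD CD [B SB H]]; split=> [//|//|/esym//|]; exists B => //; case: H; [right|left].
Qed.

(** A move of a walk multiplies a binomial by a monomial [c]. If [c] has a
    variable outside sigma, the two ends are linked; otherwise the binomial is in
    the class of the fiber, and its terms have the same parts outside sigma as the
    ends of the move, so it is an edge between their components unless these are
    equal. *)
Lemma gamma_connectedP S : S `<=` lattice_ideal k L ->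
  (forall C D, gamma_vert k L F C -> gamma_vert k L F D ->
     rst (gamma_edge L S F) C D) <->
  (forall u v, F u -> F v -> walk L S u v).
Proof.
move=> SI; split=> [conS u v Fu Fv|walkS C D /gamma_vertP[u Fu ->] /gamma_vertP[v Fv ->]].
  have walk_cls a b w : F a -> F b -> cls a = cls w -> cls b = cls w -> walk L S a b.
    by move=> Fa Fb aw bw; apply/linked_walk/cls_eqP => //; rewrite aw bw.
  pose E C D := (gamma_vert k L F C <-> gamma_vert k L F D) /\
    forall a b, F a -> F b -> C = cls a -> D = cls b -> walk L S a b.
  suff sub : forall C D, rst (gamma_edge L S F) C D -> E C D.
    have [_ uv] := sub (cls u) (cls v) (conS _ _ ((gamma_vertP _).2 (ex_intro2 _ _ u Fu erefl))
      ((gamma_vertP _).2 (ex_intro2 _ _ v Fv erefl))).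
    exact: uv.
  apply: rst_least => [C|C D [CD lCD]|C D H [CD lCD] [DH lDH]|C D CD].
  - by split=> // a b Fa Fb -> ab; apply: walk_cls ab _.
  - by split=> [|a b Fa Fb aD bC]; [apply: iff_sym|apply: rstC; apply: lCD].
  - split=> [|a b Fa Fb aC bH]; first exact: iff_trans DH.
    have /gamma_vertP[c Fc cD] : gamma_vert k L F D by apply/CD/gamma_vertP; exists a.
    exact: rstT (lCD a c _ _ _ _) (lDH c b _ _ _ _).
  split=> [|a b Fa Fb aC bD]; first by case: CD.
  have [_ [a' [b' [nab Sab aF CDab]]]] := (gamma_edgeP C D SI).1 CD.
  have ab : eqv L a' b' by apply: sub_lattice_eqv Sab.
  have [c [ic Fca]] := class_lift aF.
  have Fcb : F (c + b')%MM by apply: fiber_eqv Fca _; rewrite eqv_addl.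
  have step : walk L S (c + a')%MM (c + b')%MM.
    by apply: rst_step1; right; exists a', b', c.
  case: CDab; rewrite aC bD => -[aE bE].
    apply: rstT (walk_cls a _ a' Fa Fca _ _) _ => //; first by rewrite restr_addl.
    by apply: rstT step (walk_cls _ b b' Fcb Fb _ _) => //; rewrite restr_addl.
  apply: rstT (walk_cls a _ b' Fa Fcb _ _) _ => //; first by rewrite restr_addl.
  by apply: rstT (rstC step) (walk_cls _ b a' Fca Fb _ _) => //; rewrite restr_addl.
have {Fv} := walkS _ _ Fu Fv; move=> uv; move: u v uv Fu.
apply: (rst_bind_in latL (R' := gamma_edge L S F) (h := fun u => cls u))
  => [a b ab Fa|a b|a b step Fa].
- exact: fiber_eqv Fa ab.
- exact: walk_step_eqv.
have ab : eqv L a b := walk_step_eqv latL SI step.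
have Fb := fiber_eqv Fa ab.
case: step => [lab|[a' [b' [c [Sab ea eb]]]]].
  by have /cls_eqP -> := rst_step1 lab => //; apply: rst_id.
have [ic|nic] := pselect (insig L c); last first.
  have /cls_eqP -> // : linked L a b; last exact: rst_id.
  by rewrite ea eb; apply: linked_addr => //; apply: sub_lattice_eqv Sab.
have [->|nab] := pselect (cls a = cls b); first exact: rst_id.
apply: rst_step1; apply/(gamma_edgeP _ _ SI); split=> //; exists a', b'; split=> //.
- by apply: contra_notN nab => /eqP ab'; rewrite ea eb ab'.
- apply: (fiber_equiv_trans _ (fiber_equiv_mem Fa)); rewrite ea.
  exact/fiber_equiv_addl.
- by left; rewrite ea eb !restr_addl.
Qed.

End Fiber.
End Gamma.

(** * Spanning trees and numbers of binomials *)

Lemma card_uniq_seq (T : choiceType) (s : seq T) : uniq s -> ([set` s] #= `I_(size s))%card.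
Proof.
move=> us; have -> : [set` s] = [set` [fset x in s]%fset].
  by apply/seteqP; split=> x; rewrite /= in_fset.
by apply/card_eq_fsetP; rewrite card_fseq undup_id.
Qed.

Lemma card_sub_eq (T : choiceType) (A A' : set T) m :
  (A #= `I_m)%card -> A' `<=` A -> (`I_m #<= A')%card -> A' = A.
Proof.
move=> cardA A'A leA'; have finA : finite_set A by apply/finite_setP; exists m.
have finA' : finite_set A' by apply: sub_finite_set finA.
suff eqA : fset_set A' = fset_set A by rewrite -(fset_setK finA) -(fset_setK finA') eqA.
apply/eqP; rewrite eqEfcard (card_fset_set cardA) leq_card_fset_set // andbT.
by rewrite -fset_set_sub.
Qed.

Lemma finite_card_I (T : Type) (A : set T) m : finite_set A \/ (`I_m #<= A)%card.
Proof.
have [finA|/infiniteP infA] := pselect (finite_set A); [by left|right].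
exact: card_le_trans (card_leT _) infA.
Qed.

Section Trees.
Variables (k : fieldType) (n : nat) (L : set 'rV[int]_n) (latL : is_lattice L).
Variables (f : 'X_{1..n}) (nF : ~ insig L f).
Local Notation F := (fiber L f).
Local Notation cls u := (component k F (restr_sigma L u)).
Implicit Types (S T : set {mpoly k[n]}) (u v a b : 'X_{1..n}).
Implicit Types (B : {mpoly k[n]}) (C D : set (svec L)).

Definition walk_connected S : Prop := forall u v, F u -> F v -> walk L S u v.

(** Kruskal's algorithm on the binomials of the class. *)
Lemma spanning_subset S : S `<=` lattice_ideal k L ->
  finite_set (class_part L S F) -> walk_connected S ->
  exists T, [/\ T `<=` class_part L S F, (T #= `I_(fiber_t k L F).-1)%card
              & walk_connected T].
Proof.
move=> SI /finite_fsetP[X SX] conS.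
pose ends B := xget (0%MM, 0%MM)
  [set uv : 'X_{1..n} * 'X_{1..n} | uv.1 != uv.2 /\ B = binom k uv.1 uv.2].
have endsP B : class_part L S F B -> (ends B).1 != (ends B).2 /\
    B = binom k (ends B).1 (ends B).2.
  move=> BF; have [u [v [uv eB _ _ _]]] := class_partP latL BF.
  pose P := [set uv : 'X_{1..n} * 'X_{1..n} | uv.1 != uv.2 /\ B = binom k uv.1 uv.2].
  by apply: (@xgetPex _ (0%MM, 0%MM) P); exists (u, v).
pose p B := cls (ends B).1; pose q B := cls (ends B).2.
pose A := fset_set (gamma_vert k L F).
have AP C : C \in A = (C \in gamma_vert k L F).
  by rewrite in_fset_set //; apply: gamma_vert_finite.
have cls_vert u : fiber_equiv (fiber L u) F -> cls u \in A.
  move=> /(class_lift latL)[c [ic Fcu]]; rewrite AP inE.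
  by apply/gamma_vertP => //; exists (c + u)%MM; rewrite // restr_addl.
have XP B : B \in (X : seq _) <-> class_part L S F B by rewrite SX.
have endsA B : B \in (X : seq _) -> p B \in A /\ q B \in A.
  move=> /XP BF; have [neB eB] := endsP _ BF; rewrite eB in BF.
  have [_ eqB FB] := (class_part_binom latL _ _ neB).1 BF.
  split; apply: cls_vert => //.
  by rewrite -((fiberP latL _ _).2 eqB).
have [g [s' [subs' sz gP gX]]] := spanning_subseq endsA.
have gE C D : rst (gamma_edge L S F) C D -> g C = g D.
  apply: (rst_least (E := fun C D => g C = g D)) => // [x y z -> //|{}C {}D].
  move=> /(gamma_edgeP latL nF _ _ SI)[_ [a [b [nab Sab aF CD]]]].
  have ab : eqv L a b by apply: sub_lattice_eqv Sab.
  have BX : class_part L S F (binom k a b) by apply/class_part_binom.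
  have [_ eB] := endsP _ BX; have := gX _ ((XP _).2 BX).
  rewrite /p /q; case: (binom_inj nab eB) => -[<- <-]; by case: CD => -[-> ->].
exists [set` s']; split.
- by move=> B /= /(mem_subseq subs')/XP.
- have -> : (fiber_t k L F).-1 = size s'; last first.
    by apply: card_uniq_seq; apply: subseq_uniq subs' (fset_uniq _).
  rewrite /fiber_t -/A -sz.
  suff -> : [fset g C | C in A]%fset = [fset g (cls f)]%fset by rewrite cardfs1 addn1.
  have Ff : F f by apply: eqv_refl.
  have fA : cls f \in A by apply/cls_vert/fiber_equiv_refl.
  apply/fsetP => C; rewrite inE; apply/imfsetP/eqP => [[D /= DA ->]|->]; last by exists (cls f).
  have fD : rst (gamma_edge L S F) D (cls f).
    apply: ((gamma_connectedP latL nF SI).2 conS); first by move: DA; rewrite AP inE.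
    by move: fA; rewrite AP inE.
  exact: gE fD.
have S'I : [set` s'] `<=` lattice_ideal k L.
  by move=> B /= /(mem_subseq subs')/XP[/SI].
apply: (gamma_connectedP latL nF S'I).1 => C D VC VD.
have : rst (fun x y => exists2 e, e \in s' & x = p e /\ y = q e) C D.
  by apply/gP/gE; apply: ((gamma_connectedP latL nF SI).2 conS).
move: C D {VC VD}; apply: (@rst_bind _ _ _ _ id) => C D [B Bs' [-> ->]].
have BX : class_part L S F B by apply/XP/(mem_subseq subs').
have [pq|npq] := pselect (p B = q B); first by rewrite pq; apply: rst_id.
apply: rst_step1; apply/gamma_edgeP => //; split=> //.
have [neB eB] := endsP B BX; exists (ends B).1, (ends B).2; split=> //.
- by rewrite /= -eB.
- by move: BX; rewrite {1}eB => BX; have [] := (class_part_binom latL _ _ neB).1 BX.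
- by left.
Qed.

(** A spanning tree is contained in the graph. *)
Lemma fiber_t_le S : S `<=` lattice_ideal k L -> walk_connected S ->
  (`I_(fiber_t k L F).-1 #<= class_part L S F)%card.
Proof.
move=> SI conS; have [finS|//] := finite_card_I (class_part L S F) (fiber_t k L F).-1.
have [T [TS cardT _]] := spanning_subset SI finS conS.
by rewrite -(card_le_eql cardT); apply: subset_card_le.
Qed.

Lemma gamma_edge_single S C D :
  gamma_edge L S F C D <-> exists2 B, S B & gamma_edge L [set B] F C D.
Proof.
split=> [[VC VD CD [B SB H]]|[B SB [VC VD CD [_ -> H]]]].
  by exists B => //; split=> //; exists B.
by split=> //; exists B.
Qed.

Lemma gamma_edge_inj B C D (C' D' : set (svec L)) :
  gamma_edge L [set B] F C D -> gamma_edge L [set B] F C' D' ->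
  (C' = C /\ D' = D) \/ (C' = D /\ D' = C).
Proof.
have endsE X Y : gamma_edge L [set B] F X Y -> exists u v, [/\ u != v, B = binom k u v &
    (X = cls u /\ Y = cls v) \/ (X = cls v /\ Y = cls u)].
  move=> [VX VY XY [_ -> H]].
  by case: H => -[u [v [eB [_ uF] uv _ [Xu Yv]]]]; exists u, v;
    (split=> //; first by apply: contra_neq uv => ->); [left|right];
    split; apply: gamma_vert_mem.
move=> /endsE[u [v [uv eB CD]]] /endsE[u' [v' [_ eB' CD']]].
have eqB := binom_inj uv (etrans (esym eB) eB').
by case: CD => -[-> ->]; case: CD' => -[-> ->]; case: eqB => -[-> ->]; auto.
Qed.

(** A connected graph with one edge less than its number of vertices has no
    cycle: the first edge of a cycle could be removed, leaving too few edges to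
    connect all the vertices. *)
Lemma gamma_tree S : S `<=` lattice_ideal k L -> walk_connected S ->
  (class_part L S F #= `I_(fiber_t k L F).-1)%card -> gamma_spanning_tree L S F.
Proof.
move=> SI conS cardS; split.
- by exists (cls f); apply/gamma_vertP => //; exists f => //; apply: eqv_refl.
- move=> C D VC VD; apply/connected_rst => [a b|]; first exact: gamma_edge_sym.
  exact: ((gamma_connectedP latL nF SI).2 conS).
move=> [|C0 [|C1 [|C2 c]]] // _ /andP[+ uniq_c].
have C0c Y : Y \in C2 :: c -> Y <> C0.
  move=> Yc eY; move: uniq_c; rewrite cons_uniq in_cons.
  by rewrite -eY Yc orbT.
have C1c Y : Y \in C2 :: c -> Y <> C1.
  move=> Yc eY; move: uniq_c; rewrite !cons_uniq => /and3P[_ + _].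
  by rewrite -eY Yc.
move=> /= /and3P[/asboolP C01 /asboolP C12 pc].
have [B SB BC] := (gamma_edge_single S C0 C1).1 C01.
pose S' := S `\ B.
have S'I : S' `<=` lattice_ideal k L by move=> X [/SI].
have keep X Y : gamma_edge L S F X Y ->
    (X <> C0 /\ X <> C1) \/ (Y <> C0 /\ Y <> C1) -> gamma_edge L S' F X Y.
  move=> /gamma_edge_single[B' SB' XY] neXY; apply/gamma_edge_single; exists B' => //.
  split=> // eB'; rewrite eB' in XY.
  by have := gamma_edge_inj BC XY; case=> -[eX eY]; rewrite eX eY in neXY;
    case: neXY => -[].
have edge01 : rst (gamma_edge L S' F) C0 C1.
  apply: rstC; apply: (@rstT _ _ _ C2).
    by apply/rst_step1/keep => //; right; split; [apply: C0c|apply: C1c]; apply: mem_head.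
  move: C2 c C0c C1c pc {C12 uniq_c} => Y c; elim: c Y => [|X c IHc] Y C0c C1c /=.
    rewrite andbT => /asboolP YX; apply/rst_step1/keep => //.
    by left; split; [apply: C0c|apply: C1c]; apply: mem_head.
  move=> /andP[/asboolP YX pc]; apply: rstT (IHc X _ _ pc).
  - apply/rst_step1/keep => //.
    by left; split; [apply: C0c|apply: C1c]; apply: mem_head.
  - by move=> Z Zc; apply: C0c; rewrite in_cons Zc orbT.
  - by move=> Z Zc; apply: C1c; rewrite in_cons Zc orbT.
have conS' : walk_connected S'.
  apply: (gamma_connectedP latL nF S'I).1 => C D VC VD.
  have : rst (gamma_edge L S F) C D by apply: ((gamma_connectedP latL nF SI).2 conS).
  move: C D {VC VD}; apply: (@rst_bind _ _ _ _ id) => C D.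
  move=> /gamma_edge_single[B' SB' CD].
  have [eB|nB] := pselect (B' = B).
    rewrite eB in CD; case: (gamma_edge_inj BC CD) => -[-> ->] //; exact: rstC.
  by apply/rst_step1/gamma_edge_single; exists B'.
have BI : [set B] `<=` lattice_ideal k L by move=> _ ->; apply: SI.
have [_ [a [b [nab eB aF _]]]] := (gamma_edgeP latL nF _ _ BI).1 BC.
have : class_part L S F B.
  have {}eB : binom k a b = B := eB.
  rewrite -eB in SB *; apply/class_part_binom => //; split=> //.
  exact: sub_lattice_eqv SB.
rewrite -(card_sub_eq cardS _ (fiber_t_le S'I conS')).
  by move=> [[_ /(_ erefl)]].
by move=> X [[SX _] GX].
Qed.

End Trees.

(** * Generating sets of a lattice ideal *)

Section Generation.
Variables (k : fieldType) (n : nat) (L : set 'rV[int]_n) (latL : is_lattice L).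
Implicit Types (S T : set {mpoly k[n]}) (u v w a b c f : 'X_{1..n}).
Local Notation I_L := (lattice_ideal k L).
Local Notation pureL := (lattice_pure L).

Lemma conn_addl S c u v : conn S u v -> conn S (c + u)%MM (c + v)%MM.
Proof.
move: u v; apply: (@rst_bind _ _ (moves S) (moves S) (fun w => (c + w)%MM)).
move=> x y [a [b [d [Sab -> ->]]]]; apply: rst_step1; exists a, b, (c + d)%MM.
by rewrite !addmA.
Qed.

Lemma conn_mono S T u v : S `<=` T -> conn S u v -> conn T u v.
Proof.
move=> ST; move: u v; apply: (@rst_bind _ _ (moves S) (moves T) id).
by move=> x y [a [b [c [/ST Tab -> ->]]]]; apply: rst_step1; exists a, b, c.
Qed.

Lemma gen_connP S : S `<=` I_L -> S `<=` is_binomial k ->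
  ideal_gen S = I_L <-> forall u v, eqv L u v -> conn S u v.
Proof.
move=> SI Sbin.
have Sbin' B : S B -> exists a b, B = binom k a b.
  by move=> /Sbin[a [b [_ ->]]]; exists a, b.
split=> [genS u v uv|conS].
  by apply/ideal_gen_binomP => //; rewrite genS; apply/lattice_idealP.
apply/seteqP; split.
  by apply: ideal_gen_sub => //; apply: lattice_ideal_ideal.
apply: ideal_gen_sub; first exact: ideal_gen_ideal.
by move=> _ [u [v [uv ->]]]; apply/ideal_gen_binomP => //; apply: conS.
Qed.

Lemma eqv_pureP u v : eqv pureL u v <-> eqv L u v /\ sigma_eq L u v.
Proof.
rewrite /eqv lattice_pureP //; split=> -[uv suv]; split=> // i.
  move=> nsi; apply/eqP; apply: contra_notT nsi => neq_uv; apply: suv.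
  by rewrite mxE subr_eq0 eqz_nat.
by rewrite mxE => ne; apply: contrapT => /suv uvi; rewrite uvi subrr eqxx in ne.
Qed.

(** Two monomials congruent modulo the pure sublattice agree outside sigma, so
    dividing them by their common factor leaves monomials in the variables of
    sigma. *)
Lemma class1_genP S :
  lattice_ideal k pureL = ideal_gen (class_part L S (fiber1 L)) <->
  forall u v, insig L u -> eqv L u v -> conn (class_part L S (fiber1 L)) u v.
Proof.
have binS B : class_part L S (fiber1 L) B -> exists a b, B = binom k a b.
  by move=> BF; have [a [b [_ -> _ _ _]]] := class_partP latL BF; exists a, b.
have zero u i : insig L u -> ~ lattice_sigma L i -> u i = 0%N.
  by move=> iu nsi; case: (posnP (u i)) => // /iu.
have insig_pure u v : insig L u -> eqv L u v -> eqv pureL u v.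
  move=> iu uv; apply/eqv_pureP; split=> // i nsi.
  by rewrite !zero //; apply: insig_eqv uv iu.
split=> [gen1 u v iu uv|con1].
  apply/(ideal_gen_binomP _ _ binS); rewrite -gen1.
  apply: (lattice_idealP _ (lattice_pure_lattice L) _ _).2; exact: insig_pure.
apply/seteqP; split; apply: ideal_gen_sub; try exact: ideal_gen_ideal.
  move=> _ [u [v [/eqv_pureP[uv suv] ->]]]; apply/ideal_gen_binomP => //.
  pose m := [multinom minn (u i) (v i) | i < n].
  have mu : (m + (u - m) = u)%MM.
    by rewrite addmC submK //; apply/mnm_lepP => i; rewrite mnmE geq_minl.
  have mv : (m + (v - m) = v)%MM.
    by rewrite addmC submK //; apply/mnm_lepP => i; rewrite mnmE geq_minr.
  rewrite -mu -mv; apply/conn_addl/con1; last by rewrite -(eqv_addl L m) mu mv.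
  move=> i; rewrite mnmBE mnmE subn_gt0 => lt_uv.
  by apply: contrapT => /suv uvi; rewrite uvi minnn ltnn in lt_uv.
move=> B BF; have [a [b [_ -> _ ab aF]]] := class_partP latL BF.
apply: (lattice_idealP _ (lattice_pure_lattice L) _ _).2; apply: insig_pure ab.
by apply/(fiber_equiv1P latL).
Qed.

(** The degree outside sigma. It is bounded on each fiber, and its maximum
    strictly increases from a fiber to a strictly larger one. *)
Definition sdeg (x : svec L) : nat := (\sum_i x i)%N.

Lemma sdegD u v : sdeg (restr_sigma L (u + v)%MM) =
  (sdeg (restr_sigma L u) + sdeg (restr_sigma L v))%N.
Proof. by rewrite /sdeg -big_split; apply: eq_bigr => i _; rewrite !ffunE mnmDE. Qed.

Lemma sdeg_gt0 u : ~ insig L u -> (0 < sdeg (restr_sigma L u))%N.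
Proof.
move=> /not_insigP[i nsi ui].
have nsi' : i \notin lattice_sigma L by apply/negP; rewrite inE.
by rewrite /sdeg (bigD1 (exist _ i nsi')) //= ffunE /= ltn_addr.
Qed.

Lemma sdeg_bounded f : exists N, forall u, fiber L f u -> (sdeg (restr_sigma L u) < N)%N.
Proof.
have /finite_fsetP[X FX] := fvert_finite k latL f.
exists (\sum_(x <- X) sdeg x).+1 => u Fu; rewrite ltnS.
have uX : restr_sigma L u \in X.
  by have : fvert k L (fiber L f) (restr_sigma L u) by [apply: fvert_restr]; rewrite FX.
by rewrite (big_rem _ uX) /= leq_addr.
Qed.

(** Links lead to strictly smaller fibers, hence induction over the fibers
    turns walks into sequences of moves. *)
Lemma walk_conn S : S `<=` I_L -> (forall f, ~ insig L f -> walk_connected L f S) ->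
  (forall u v, insig L u -> eqv L u v -> conn S u v) ->
  forall u v, eqv L u v -> conn S u v.
Proof.
move=> SI walkS con1 u; have [N] := sdeg_bounded u.
elim: N u => [|N IHN] u bound v uv.
  by have := bound u (eqv_refl latL u).
have [iu|nu] := pselect (insig L u); first exact: con1.
have Fu : fiber L u u by apply: eqv_refl.
have Fv : fiber L u v by apply: eqv_sym.
have := walkS u nu u v Fu Fv; suff sub x y : walk L S x y -> fiber L u x -> conn S x y.
  by move=> /sub; apply.
move: x y; apply: (rst_bind_in latL (R' := moves S) (h := id)) => [x y xy Fx|x y|x y step Fx].
- exact: fiber_eqv Fx xy.
- exact: walk_step_eqv.
case: step => [/linkstep_split[c [a [b [nic ab ex ey]]]]|]; last exact: rst_step1.
rewrite ex ey; apply/conn_addl/IHN => // w Fw.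
have /bound : fiber L u (c + w)%MM.
  by apply: fiber_eqv Fx _; rewrite // ex eqv_addl; apply: eqv_sym.
by rewrite sdegD; have := sdeg_gt0 nic; lia.
Qed.

Lemma class_part_sub S F : class_part L S F `<=` S. Proof. by move=> B []. Qed.

(** A chain of moves is in particular a walk; between monomials in the variables
    of sigma, it only multiplies by such monomials, hence only uses binomials of
    the class of the fiber of 1. The converse is [walk_conn]. *)
Lemma generates_walkP S : S `<=` I_L -> S `<=` is_binomial k ->
  ideal_gen S = I_L <->
  (forall f, ~ insig L f -> walk_connected L f S) /\
  lattice_ideal k pureL = ideal_gen (class_part L S (fiber1 L)).
Proof.
move=> SI Sbin; rewrite gen_connP // class1_genP; split=> [conS|[walkS con1]].
  split=> [f nf u v Fu Fv|u v iu uv].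
    exact/conn_walk/conS/(eqv_fiber latL Fu Fv).
  have := conS u v uv; move=> {}uv; move: u v uv iu.
  apply: (rst_bind_in latL (R' := moves (class_part L S (fiber1 L))) (h := id)) => [x y|x y|].
  - exact: insig_eqv.
  - by move=> [a [b [c [Sab -> ->]]]]; rewrite eqv_addl; apply: sub_lattice_eqv Sab.
  move=> _ _ [a [b [c [Sab -> ->]]]] /insigD[_ ia]; have ab := sub_lattice_eqv latL SI Sab.
  have [<-|/eqP nab] := pselect (a = b); first exact: rst_id.
  apply: rst_step1; exists a, b, c; split=> //.
  by apply/class_part_binom => //; split=> //; apply/fiber_equiv1P.
apply: walk_conn => // u v iu uv; apply: conn_mono (con1 u v iu uv).
exact: class_part_sub.
Qed.

(** * Finite generation *)

(** A pair of congruent exponents that is not minimal is the sum of a smaller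
    pair and of the remaining pair, so the finitely many minimal pairs give
    generators. *)
Lemma finite_binomial_generators : exists G,
  [/\ finite_set G, G `<=` is_binomial k, G `<=` I_L & ideal_gen G = I_L].
Proof.
pose pair_le (p q : 'X_{1..n} * 'X_{1..n}) := (p.1 <= q.1)%MM /\ (p.2 <= q.2)%MM.
pose P := [set p : 'X_{1..n} * 'X_{1..n} | eqv L p.1 p.2 /\ p.1 != p.2].
pose A := [set q | P q /\ forall p, P p -> pair_le p q -> p = q].
pose G := [set binom k p.1 p.2 | p in A].
have finA : finite_set A.
  pose g (p : 'X_{1..n} * 'X_{1..n}) (t : bool * 'I_n) :=
    if t.1 then p.1 t.2 else p.2 t.2.
  apply: (@finite_antichain _ _ _ g) => p q [Pp _] [_ minq] pq; apply: minq => //.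
  by split; apply/mnm_lepP => i; [apply: (pq (true, i))|apply: (pq (false, i))].
have Gbin : G `<=` is_binomial k by move=> _ [p [[_ np] _] <-]; exists p.1, p.2.
have GI : G `<=` I_L by move=> _ [p [[ep _] _] <-]; apply/lattice_idealP.
exists G; split=> //; first exact: finite_image.
apply/gen_connP => // u v; have [N] := ubnP (mdeg u + mdeg v).
elim: N u v => // N IHN u v; rewrite ltnS => le_N uv.
have [<-|/eqP nuv] := pselect (u = v); first exact: rst_id.
have [Auv|nA] := pselect (A (u, v)).
  by apply: rst_step1; exists u, v, 0%MM; rewrite !add0m; split=> //; exists (u, v).
have [[p q] [[/= pq npq] [/= pu qv] neq]] :
    exists x, [/\ P x, pair_le x (u, v) & x <> (u, v)].
  apply: contrapT => no; apply: nA; split=> // x Px xuv.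
  by apply: contrapT => nx; apply: no; exists x.
pose a := (u - p)%MM; pose b := (v - q)%MM.
have eu : (a + p)%MM = u by rewrite submK.
have ev : (b + q)%MM = v by rewrite submK.
have ab : eqv L a b.
  rewrite -(eqv_addl L q) ![(q + _)%MM]addmC ev.
  by apply: (eqv_trans latL _ uv); rewrite -eu eqv_addl; apply: eqv_sym.
have := congr1 mdeg eu; have := congr1 mdeg ev; rewrite !mdegD => dv du.
have pq_gt0 : (0 < mdeg p + mdeg q)%N.
  rewrite lt0n addn_eq0 !mdeg_eq0; apply: contra npq => /andP[/eqP-> /eqP->].
  exact: eqxx.
have ab_gt0 : (0 < mdeg a + mdeg b)%N.
  rewrite lt0n addn_eq0 !mdeg_eq0; apply/negP => /andP[/eqP a0 /eqP b0].
  by apply: neq; rewrite -eu -ev a0 b0 !add0m.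
rewrite -eu -ev; apply: (@rstT _ _ _ (a + q)%MM).
  by apply/conn_addl/IHN => //; lia.
by rewrite ![(_ + q)%MM]addmC; apply/conn_addl/IHN => //; lia.
Qed.

(** Each of finitely many generators of the ideal lies in the ideal of a finite
    part of [S]. *)
Lemma min_gen_set_finite S : min_gen_set I_L S -> finite_set S.
Proof.
move=> [Sbin genS minS]; have [G [finG Gbin GI genG]] := finite_binomial_generators.
have /choice[c cP] B : exists S', G B -> [/\ S' `<=` S, finite_set S' & ideal_gen S' B].
  have [GB|] := pselect (G B); last by exists set0.
  have /ideal_gen_finite[S' S'P] : ideal_gen S B by rewrite genS; apply: GI.
  by exists S'.
pose S' := \bigcup_(B in G) c B.
have finS' : finite_set S' by apply: bigcup_finite => // B /cP[].
have S'S : S' `<=` S by move=> B [C /cP[sub _ _] /sub].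
suff genS' : ideal_gen S' = I_L by rewrite -(minS S').
apply/seteqP; split; first by rewrite -genS; apply: ideal_gen_mono.
rewrite -genG; apply: ideal_gen_sub; first exact: ideal_gen_ideal.
move=> B GB; have [_ _] := cP B GB; apply: ideal_gen_mono.
by move=> C cC; exists B.
Qed.

End Generation.

(** * Bases of lattices *)

Section Bases.
Variables (n : nat).
Implicit Types (P : set 'rV[int]_n).

Definition row_lattice m (M : 'M[int]_(m, n)) : set 'rV[int]_n :=
  range (fun z : 'rV[int]_m => z *m M).

Lemma row_latticeP m (M : 'M[int]_(m, n)) : is_lattice (row_lattice M).
Proof.
split=> [|_ _ [z _ <-] [t _ <-]]; first by exists 0; rewrite // mul0mx.
by exists (z - t); rewrite // mulmxBl.
Qed.

Lemma row_in_lattice m (M : 'M[int]_(m, n)) i : row_lattice M (row i M).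
Proof. by exists (delta_mx 0 i); rewrite // -rowE. Qed.

Lemma row_lattice_unit m (U : 'M[int]_m) (M : 'M[int]_(m, n)) : U \in unitmx ->
  row_lattice (U *m M) = row_lattice M.
Proof.
move=> Uu; apply/seteqP; split=> _ [z _ <-].
  by exists (z *m U); rewrite // mulmxA.
by exists (z *m invmx U); rewrite // mulmxA mulmxKV.
Qed.

(** An integer vector is a multiple of the first row of a unimodular matrix, by
    the Smith normal form of a matrix with one row. *)
Lemma unimodular_row m (c : 'rV[int]_m.+1) :
  exists2 U : 'M[int]_m.+1, U \in unitmx & exists x, c = x *: row 0 U.
Proof.
have [A _ [U Uu [d _ ->]]] := int_Smith_normal_form c.
exists U => //; exists (A 0 0 * d`_0); rewrite rowE scalemxAl; congr (_ *m U).
apply/rowP => j; rewrite !mxE big_ord1 !mxE eqxx /=.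
by case: (unliftP ord0 j) => [j'|] -> /=; rewrite ?mulr1n ?mulr1 ?mulr0n ?mulr0.
Qed.

(** A generating matrix with the least number of rows is a basis: a relation
    between its rows would become, after a unimodular change of generators, the
    vanishing of one of them. *)
Lemma exists_Zbasis m (M : 'M[int]_(m, n)) : exists r, exists b : 'M[int]_(r, n),
  Zbasis (row_lattice M) b.
Proof.
have ex : exists r, `[< exists b : 'M[int]_(r, n), row_lattice M = row_lattice b >].
  by exists m; apply/asboolP; exists M.
case: (ex_minnP ex) => r /asboolP[b Mb] minr; exists r, b; split=> //.
suff ker0 (z : 'rV_r) : z *m b = 0 -> z = 0.
  by move=> x y /eqP; rewrite -subr_eq0 -mulmxBl => /eqP/ker0/eqP; rewrite subr_eq0 => /eqP.
move=> zb; apply/eqP; apply: contraT => nz.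
case: r b Mb minr z zb nz => [|r] b Mb minr z zb nz.
  by case/eqP: nz; apply/rowP => -[].
have [U Uu [x ex_z]] := unimodular_row z.
have nx : x != 0 by apply: contraNneq nz => x0; rewrite ex_z x0 scale0r.
have row0 : row 0 (U *m b) = 0.
  apply/rowP => j; have /rowP/(_ j) := zb.
  rewrite ex_z -scalemxAl -row_mul !mxE => /eqP; rewrite mulf_eq0 (negbTE nx) /=.
  by move/eqP.
pose b' : 'M[int]_(r, n) := row' 0 (U *m b).
suff : (r.+1 <= r)%N by rewrite ltnn.
apply: minr; apply/asboolP; exists b'; rewrite Mb -(row_lattice_unit b Uu).
apply/seteqP; split=> _ [t _ <-].
  rewrite mulmx_sum_row big_ord_recl row0 scaler0 add0r.
  apply: (lattice_sum (row_latticeP b')) => i; apply: (latticeZ (row_latticeP b')).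
  suff -> : row (lift ord0 i) (U *m b) = row i b' by apply: row_in_lattice.
  by rewrite row_rowsub.
apply: (lattice_mulmx (row_latticeP _)) => i.
have -> : row i b' = row (lift ord0 i) (U *m b) by rewrite row_rowsub.
exact: row_in_lattice.
Qed.

Lemma lattice_rankP m (M : 'M[int]_(m, n)) :
  exists b : 'M[int]_(lattice_rank (row_lattice M), n), Zbasis (row_lattice M) b.
Proof.
exact: (@xgetPex _ 0%N [set r | exists b : 'M_(r, n), Zbasis _ b] (exists_Zbasis M)).
Qed.

(** The matrices expressing the basis and the generators in terms of each other
    have the identity as product. *)
Lemma Zbasis_rank_le P r m (b : 'M[int]_(r, n)) (M : 'M[int]_(m, n)) :
  Zbasis P b -> P = row_lattice M -> (r <= m)%N.
Proof.
move=> [bI Pb] PM.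
have /choice[A AP] i : exists z, z *m M = row i b.
  have : row_lattice M (row i b) by rewrite -PM Pb; apply: row_in_lattice.
  by case=> z _; exists z.
have /choice[B BP] i : exists z, z *m b = row i M.
  have : range (fun c => c *m b) (row i M) by rewrite -Pb PM; apply: row_in_lattice.
  by case=> z _; exists z.
pose A' := \matrix_i A i; pose B' := \matrix_i B i.
have eA : A' *m M = b by apply/row_matrixP => i; rewrite row_mul rowK AP.
have eB : B' *m b = M by apply/row_matrixP => i; rewrite row_mul rowK BP.
apply: (@mulmx1_min _ _ _ A' B'); apply/row_matrixP => i; apply: bI.
by rewrite -!row_mul -mulmxA eB eA mul1mx.
Qed.

End Bases.

(** * Generators of the ideal of a lattice *)

Section Generators.
Variables (k : fieldType) (n : nat).
Implicit Types (L P D : set 'rV[int]_n) (S T : set {mpoly k[n]}).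

(** For [x] in [P], a chain of moves leads from the positive part of [x] to its
    negative part, and each move changes the exponent by the difference of a
    generator. *)
Lemma lattice_sub_differences P D T : is_lattice P -> is_lattice D ->
  T `<=` is_binomial k -> ideal_gen T = lattice_ideal k P ->
  (forall a b, T (binom k a b) -> D (mnm_diff a b)) -> P `<=` D.
Proof.
move=> latP latD Tbin genT TD x Px; rewrite -[x]mnm_diff_parts.
suff : conn T (pos_part x) (neg_part x) by apply: (conn_eqv latD).
apply: (ideal_gen_binomP _ _ _).1.
  by move=> B /Tbin[a [b [_ ->]]]; exists a, b.
by rewrite genT; apply/lattice_idealP => //; rewrite /eqv mnm_diff_parts.
Qed.

Lemma row_lattice_differences P T : is_lattice P ->
  T `<=` is_binomial k -> ideal_gen T = lattice_ideal k P -> forall m, (T #= `I_m)%card ->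
  exists M : 'M[int]_(m, n), P = row_lattice M.
Proof.
move=> latP Tbin genT m cardT.
have finT : finite_set T by apply/finite_setP; exists m.
have [X TX] := finite_fsetP.1 finT.
have szX : size (X : seq _) = m by apply/eqP; rewrite TX in cardT; apply/eqP/card_eq_fsetP.
have /choice[c cP] B : exists uv : 'X_{1..n} * 'X_{1..n}, T B ->
    uv.1 != uv.2 /\ B = binom k uv.1 uv.2.
  have [/Tbin[u [v uv]]|] := pselect (T B); last by exists (0%MM, 0%MM).
  by exists (u, v).
have TI : T `<=` lattice_ideal k P by rewrite -genT; apply: sub_ideal_gen.
pose Xn i := nth 0 (X : seq {mpoly k[n]}) i.
pose M : 'M[int]_(m, n) := \matrix_(i < m) mnm_diff (c (Xn i)).1 (c (Xn i)).2.
have TXn (i : 'I_m) : T (Xn i) by rewrite TX /=; apply: mem_nth; rewrite szX.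
exists M; apply/seteqP; split; last first.
  move=> _ [z _ <-]; apply: lattice_mulmx => // i; rewrite rowK.
  have [_ eB] := cP _ (TXn i).
  by apply: (sub_lattice_eqv latP TI); rewrite -eB.
apply: lattice_sub_differences genT _ => // [|a b Tab]; first exact: row_latticeP.
have TabX : binom k a b \in (X : seq _) by move: Tab; rewrite TX.
have iX : (index (binom k a b) (X : seq _) < m)%N by rewrite -szX index_mem.
have := row_in_lattice M (Ordinal iX); rewrite rowK /= /Xn nth_index //.
have [_ eB] := cP _ Tab.
have [->|/eqP nab] := pselect (a = b).
  by move=> _; rewrite mnm_diffxx; apply: lattice0; apply: row_latticeP.
case: (binom_inj nab eB) => -[<- <-] // Dba.
by rewrite mnm_diffC; apply: (latticeN (row_latticeP M)).
Qed.

(** The exponent differences of the generators generate the lattice, so they are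
    at least as many as the elements of a basis. *)
Lemma rank_le_generators P T : is_lattice P ->
  T `<=` is_binomial k -> ideal_gen T = lattice_ideal k P ->
  (`I_(lattice_rank P) #<= T)%card.
Proof.
move=> latP Tbin genT; have [finT|//] := finite_card_I T (lattice_rank P).
have /finite_setP[m cardT] := finT.
have [M PM] := row_lattice_differences latP Tbin genT cardT.
rewrite (card_le_eqr cardT) card_le_II.
have := lattice_rankP M; rewrite -PM => -[b Pb].
exact: Zbasis_rank_le Pb PM.
Qed.

Lemma lattice_Zbasis P : is_lattice P -> exists b : 'M[int]_(lattice_rank P, n), Zbasis P b.
Proof.
move=> latP; have [G [finG Gbin _ genG]] := finite_binomial_generators k latP.
have /finite_setP[m cardG] := finG.
have [M PM] := row_lattice_differences latP Gbin genG cardG.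
by rewrite PM; apply: lattice_rankP.
Qed.

Section Pure.
Variables (L : set 'rV[int]_n) (latL : is_lattice L).
Local Notation pureL := (lattice_pure L).
Local Notation r := (lattice_rank pureL).

(** The primitive vector proportional to a full vector of sigma belongs, up to
    sign, to a basis of the pure sublattice. *)
Lemma pure_basis : exists b : 'M[int]_(r, n), Zbasis pureL b /\
  ((forall i, ~ lattice_sigma L i) \/
   exists j (w : 'X_{1..n}), (row j b = mnm_diff w 0 \/ row j b = mnm_diff 0 w) /\
     forall i, lattice_sigma L i -> (0 < w i)%N).
Proof.
have [b bB] := lattice_Zbasis (lattice_pure_lattice L).
have [sigma0|/existsNP[i0 /contrapT si0]] := pselect (forall i, ~ lattice_sigma L i).
  by exists b; split=> //; left.
have [w0 Lw0 w0P] := sigma_full_vector latL.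
have : pureL (mnm_diff w0 0).
  by apply/lattice_pureP => //; split=> // i; rewrite !mxE mnm0E subr0 => wi; apply/w0P; lia.
case: bB; move: b; case: r => [|r'] b bI bE.
  rewrite {1}bE => -[z _]; have -> : z = 0 by apply/rowP => -[].
  rewrite mul0mx => /rowP/(_ i0); rewrite !mxE mnm0E subr0.
  by have /w0P := si0; case: (w0 i0).
rewrite {1}bE => -[c _ cb]; have [U Uu [x ex]] := unimodular_row c.
exists (U *m b); split.
  split; last by rewrite bE; apply/esym/row_lattice_unit.
  move=> y z; rewrite !mulmxA => /bI yz.
  by rewrite -[y](mulmxK Uu) yz mulmxK.
right; exists 0; pose w := [multinom absz (row ord0 (U *m b) ord0 i) | i < n].
have xw i : x * row 0 (U *m b) ord0 i = w0 i.
  have /rowP/(_ i) := cb; rewrite ex -scalemxAl -row_mul !mxE mnm0E subr0.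
  by move=> ->.
have wE i : w i = absz (row ord0 (U *m b) ord0 i) by rewrite mnmE.
exists w; split; last first.
  move=> i /w0P w0i; rewrite wE lt0n absz_eq0; apply/eqP => t0.
  by have := xw i; rewrite t0 mulr0; lia.
have x_neq0 : x != 0.
  by apply/eqP => x0; have := xw i0; rewrite x0 mul0r; have /w0P := si0; lia.
have [x_gt0|x_le0] := ltP 0 x; [left|right]; apply/rowP => i;
  rewrite [RHS]mxE mnm0E wE; move: (xw i); move: (row 0 _ _ _) => t; nia.
Qed.

(** As a basis vector that is positive on sigma makes the monomials in the
    variables of sigma invertible, the binomials of the other basis vectors give
    all the congruences of the pure sublattice. *)
Lemma pure_generators : exists T, [/\ T `<=` is_binomial k,
  (T #<= `I_r)%card, (forall B, T B -> exists a b, [/\ B = binom k a b, insig L a & eqv L a b])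
  & forall u v, insig L u -> eqv L u v -> conn T u v].
Proof.
have [b [[bI bE] bpos]] := pure_basis.
have pureb j : pureL (row j b) by have := row_in_lattice b j; rewrite /row_lattice -bE.
have rowbP j : L (row j b) /\ forall i, row j b ord0 i != 0 -> lattice_sigma L i.
  exact/(lattice_pureP latL).
pose B j := binom k (pos_part (row j b)) (neg_part (row j b)).
pose T := range B.
have Tmove j : conn T (pos_part (row j b)) (neg_part (row j b)).
  apply: rst_step1; exists (pos_part (row j b)), (neg_part (row j b)), 0%MM.
  by rewrite !add0m; split=> //; exists j.
have conn_diff j u v : mnm_diff u v = row j b -> conn T u v.
  move=> uv.
  pose m := [multinom minn (u i) (v i) | i < n].
  have eu : u = (m + pos_part (row j b))%MM.
    apply/mnmP => i; rewrite mnmDE !mnmE -uv !mxE.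
    by case E : (_ - _)%R => [p|p]; lia.
  have ev : v = (m + neg_part (row j b))%MM.
    apply/mnmP => i; rewrite mnmDE !mnmE -uv !mxE.
    by case E : (_ - _)%R => [p|p]; lia.
  by rewrite eu ev; apply: conn_addl.
have [w [w0 wpos]] : exists w, conn T w 0%MM /\ forall i, lattice_sigma L i -> (0 < w i)%N.
  case: bpos => [nosigma|[j [w [wj wpos]]]].
    by exists 0%MM; split=> [|i /nosigma//]; apply: rst_id.
  exists w; split=> //; case: wj => /esym/conn_diff //.
  exact: rstC.
have mulw N : conn T (w *+ N)%MM 0%MM.
  elim: N => [|N IHN]; first by rewrite mulm0n; apply: rst_id.
  by rewrite mulmS; have := conn_addl w IHN; rewrite addm0 => /rstT; apply.
have dominated y : insig L y -> exists y', conn T (y' + y)%MM 0%MM.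
  move=> iy; exists (w *+ mdeg y - y)%MM; rewrite submK //.
  apply/mnm_lepP => i; rewrite mulmnE; case: (posnP (y i)) => [->//|/iy/wpos w_gt0].
  by rewrite (leq_trans (le_mdeg y i)) // leq_pmull.
have cancel y u v : insig L y -> conn T (y + u)%MM (y + v)%MM -> conn T u v.
  move=> /dominated[y' y'0] yuv.
  have un x : conn T (y' + (y + x))%MM x.
    by have := conn_addl x y'0; rewrite addm0 addmC -addmA.
  exact: rstT (rstC (un u)) (rstT (conn_addl y' yuv) (un v)).
(* It remains to see that the differences realized by chains of moves form a
   lattice; the sum of two of them needs an intermediate exponent. *)
pose D := [set x : 'rV[int]_n | (forall i, x ord0 i != 0 -> lattice_sigma L i) /\
  forall u v, mnm_diff u v = x -> conn T u v].
have latD : is_lattice D.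
  split.
    split=> [i|u v /rowP uv]; first by rewrite mxE eqxx.
    suff -> : u = v by apply: rst_id.
    by apply/mnmP => i; have := uv i; rewrite !mxE; lia.
  move=> x y [sx Dx] [sy Dy]; split=> [i|u v uv].
    rewrite !mxE; case: (eqVneq (x ord0 i) 0) => [->|/sx//].
    by rewrite sub0r oppr_eq0 => /sy.
  (* Multiplication by [z] makes room for the intermediate exponent [m], which
     is [z + v - y]. *)
  pose z := (pos_part y + neg_part y)%MM.
  have iz : insig L z.
    by move=> i; rewrite mnmDE !mnmE => zi; apply: sy; move: zi; case: (y ord0 i) => [[|]|].
  pose m := (z + v + neg_part y - pos_part y)%MM.
  apply: (cancel z) => //; apply: (@rstT _ _ _ m); last apply: rstC.
    apply: Dx; apply/rowP => i; move/rowP/(_ i): uv; rewrite !mxE /m /z !mnmE.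
    by move: (x _ i) (y _ i) => s [p|p]; lia.
  apply: Dy; apply/rowP => i; rewrite !mxE /m /z !mnmE.
  by move: (y _ i) => [p|p]; lia.
have TP Y : T Y -> exists a b, [/\ Y = binom k a b, insig L a & eqv L a b].
  move=> [j _ <-]; exists (pos_part (row j b)), (neg_part (row j b)); split=> //.
    move=> i; rewrite mnmE => pi; apply: (rowbP j).2; move: pi.
    by case: (row j b ord0 i) => [[|]|].
  by rewrite /eqv mnm_diff_parts; case: (rowbP j).
exists T; split=> //.
- move=> _ [j _ <-]; exists (pos_part (row j b)), (neg_part (row j b)); split=> //.
  apply/eqP => pn; have bj0 : row j b = 0 by rewrite -[row j b]mnm_diff_parts pn mnm_diffxx.
  have /bI/rowP/(_ j) : (delta_mx 0 j : 'rV[int]_r) *m b = 0 *m b.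
    by rewrite -rowE bj0 mul0mx.
  by rewrite !mxE !eqxx.
- apply: (card_le_trans (card_image_le _ _)).
  by rewrite (card_le_eqr card_II).
- move=> u v iu uv.
  have : pureL (mnm_diff u v).
    apply/lattice_pureP => //; split=> // i; rewrite mxE => ne.
    have [u0|] := posnP (u i); last exact: iu.
    have iv : insig L v by apply: insig_eqv uv iu.
    by apply: iv; lia.
  rewrite bE => -[c _ cb].
  suff : D (mnm_diff u v) by case=> _; apply.
  rewrite -cb; apply: (lattice_mulmx latD) => j; split; first exact: (rowbP j).2.
  exact: conn_diff.
Qed.

End Pure.
End Generators.

(** * Counting binomials in each fiber class *)

Lemma card_le_fun (U : Type) (A B : set U) : (A #<= B)%card ->
  exists g : U -> U, (forall x, A x -> B (g x)) /\
    forall x y, A x -> A y -> g x = g y -> x = y.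
Proof.
move=> /card_leP/unsquash h.
pose g x := if pselect (A x) is left Ax then val (h (SigSub (mem_set Ax))) else x.
exists g; split=> [x Ax|x y Ax Ay]; rewrite /g; case: pselect => // Ax'.
  exact: set_valP.
case: pselect => // Ay' /val_inj eq_h.
by have /(congr1 val) := 'inj_h (mem_set I) (mem_set I) eq_h.
Qed.

(** With [cl] sending a binomial to its class of fibers, this adds up comparisons
    made class by class. *)
Lemma card_le_glue (U W : Type) (cl : U -> W) (A B : set U) :
  (forall x, A x -> (A `&` [set y | cl y = cl x] #<= B `&` [set y | cl y = cl x])%card) ->
  (A #<= B)%card.
Proof.
move=> le_AB.
have /choice[g gP] w : exists g : U -> U,
    (forall x, A x -> cl x = w -> B (g x) /\ cl (g x) = w) /\
    forall x y, A x -> A y -> cl x = w -> cl y = w -> g x = g y -> x = y.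
  have [[x [Ax xw]]|no] := pselect (exists x, A x /\ cl x = w); last first.
    by exists id; split=> [x Ax xw|x y Ax _ xw]; case: no; exists x.
  have [g [gB gI]] := card_le_fun (le_AB x Ax); rewrite xw in gB gI.
  by exists g; split=> [y Ay yw|y z Ay Az yw zw]; [apply: gB|apply: gI].
pose h x := g (cl x) x.
have hB : h @` A `<=` B by move=> _ [x Ax <-]; case: ((gP (cl x)).1 x Ax erefl).
have hI : {in A &, injective h}.
  move=> x y /set_mem Ax /set_mem Ay hxy.
  have clh z : A z -> cl (h z) = cl z by move=> Az; case: ((gP (cl z)).1 z Az erefl).
  have clxy : cl x = cl y by rewrite -(clh x) // hxy clh.
  by apply: ((gP (cl x)).2 x y Ax Ay) => //; rewrite {2}clxy.
by rewrite -(card_le_eql (inj_card_eq hI)); apply: subset_card_le.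
Qed.

Section Main.
Variables (k : fieldType) (n : nat) (L : set 'rV[int]_n) (latL : is_lattice L).
Implicit Types (S T : set {mpoly k[n]}) (u v a b f : 'X_{1..n}) (B : {mpoly k[n]}).
Implicit Types (F G : set 'X_{1..n}).
Local Notation I_L := (lattice_ideal k L).
Local Notation r := (lattice_rank (lattice_pure L)).
Local Notation F1 := (fiber1 L).

Lemma class_part_unique S T F G B :
  class_part L S F B -> class_part L T G B -> fiber_equiv F G.
Proof.
move=> BF BG; have [u [v [uv eB _ euv uF]]] := class_partP latL BF.
rewrite eB in BG; have [_ _ uG] := (class_part_binom latL _ _ uv).1 BG.
exact: fiber_equiv_trans (fiber_equiv_sym uF) uG.
Qed.

Lemma walk_mono S T u v : S `<=` T -> walk L S u v -> walk L T u v.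
Proof.
move=> ST; move: u v; apply: (@rst_bind _ _ (walk_step L S) (walk_step L T) id).
move=> x y [xy|[a [b [c [/ST Tab -> ->]]]]]; apply: rst_step1; first by left.
by right; exists a, b, c.
Qed.

(** Monomials in the variables of sigma map each of the two fibers into the other.
    The composite map keeps the parts outside sigma, so it sends each monomial to
    a linked one. *)
Lemma walk_connected_equiv S f g : fiber_equiv (fiber L g) (fiber L f) ->
  ~ insig L g -> walk_connected L f S -> walk_connected L g S.
Proof.
move=> /(fiber_equivP latL)[c ic cg] ng walkS u v gu gv.
have [d dc] := (insigP latL c).1 ic.
have lift w : fiber L g w -> fiber L f (c + w)%MM.
  by move=> gw; apply: (eqv_trans latL _ cg); rewrite eqv_addl.
have back w : fiber L g w -> walk L S (d + (c + w))%MM w.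
  move=> gw; rewrite addmA; apply/linked_walk/linked_sigma_eq.
  - exact/eqv_addl_insig.
  - by apply/sigma_eq_addl/(insigP latL); exists 0%MM; rewrite add0m.
  - by move=> /insigD[_]; apply: fiber_not_insig gw.
exact: rstT (rstC (back u gu)) (rstT (walk_addl d (walkS _ _ (lift u gu) (lift v gv))) (back v gv)).
Qed.

(** A move of the class of [F] that occurs in a walk of a fiber of another class
    comes from a smaller fiber, so a link replaces it, see [walk_class]. *)
Lemma walk_connected_other S T F f : S `<=` I_L -> ~ insig L f ->
  ~ fiber_equiv F (fiber L f) -> walk_connected L f S ->
  walk_connected L f ((S `\` class_part L S F) `|` T).
Proof.
move=> SI nf nF walkS u v Fu Fv.
apply: (walk_class latL SI _ (fiber_equiv_mem latL Fu) (walkS u v Fu Fv)).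
move=> B Bf; left; split=> [|BF]; first by case: Bf.
exact: nF (class_part_unique BF Bf).
Qed.

Lemma rank_le_class1 S : S `<=` is_binomial k ->
  lattice_ideal k (lattice_pure L) = ideal_gen (class_part L S F1) ->
  (`I_r #<= class_part L S F1)%card.
Proof.
move=> Sbin gen1; apply: (@rank_le_generators k) => //.
  exact: lattice_pure_lattice.
by apply: subset_trans Sbin; apply: class_part_sub.
Qed.

Definition optimal_counts S : Prop :=
  (forall f, ~ insig L f ->
     (class_part L S (fiber L f) #= `I_(fiber_t k L (fiber L f)).-1)%card) /\
  (class_part L S F1 #= `I_r)%card.

(** A connected graph has at least as many edges as a spanning tree, and the
    class of the fiber of 1 has at least as many binomials as the rank. *)
Lemma optimal_counts_le S T : optimal_counts S ->
  T `<=` I_L -> T `<=` is_binomial k -> ideal_gen T = I_L ->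
  forall f, (class_part L S (fiber L f) #<= class_part L T (fiber L f))%card.
Proof.
move=> [cardS cardS1] TI Tbin /(generates_walkP latL TI Tbin)[walkT gen1] f.
have [iF|nF] := pselect (insig L f).
  have f1 : fiber_equiv (fiber L f) F1 by apply/fiber_equiv1P.
  rewrite !(class_part_equiv _ _ f1) (card_le_eql cardS1); exact: rank_le_class1.
by rewrite (card_le_eql (cardS f nF)); apply: fiber_t_le => //; apply: walkT.
Qed.

Lemma optimal_counts_finite S f : optimal_counts S -> exists m,
  (class_part L S (fiber L f) #= `I_m)%card.
Proof.
move=> [cardS cardS1]; have [iF|nF] := pselect (insig L f); last first.
  by eexists; apply: cardS.
exists r; rewrite (class_part_equiv _ _ ((fiber_equiv1P latL f).2 iF)).
exact: cardS1.
Qed.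

(** By [optimal_counts_le], a generating subset has as many elements as [S] in
    each class, where [S] is finite. *)
Lemma optimal_counts_min S : S `<=` I_L -> S `<=` is_binomial k ->
  ideal_gen S = I_L -> optimal_counts S -> min_gen_set I_L S.
Proof.
move=> SI Sbin genS optS; split=> // T TS genT.
apply/seteqP; split=> // B SB; have [u [v [uv eB]]] := Sbin B SB.
rewrite {}eB in SB *; have euv := sub_lattice_eqv latL SI SB.
have Tle := optimal_counts_le optS (subset_trans TS SI) (subset_trans TS Sbin) genT u.
have [m cardSm] := optimal_counts_finite u optS.
have := class_part_self latL uv euv SB.
rewrite -(card_sub_eq cardSm (A' := class_part L T (fiber L u))).
- by case.
- by move=> C [/TS SC HC].
- by rewrite -(card_le_eql cardSm).
Qed.

(** The classes partition the binomials, so the inequalities of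
    [optimal_counts_le] add up. *)
Lemma optimal_counts_card_min S : S `<=` I_L -> S `<=` is_binomial k ->
  ideal_gen S = I_L -> optimal_counts S -> card_min_gen_set I_L S.
Proof.
move=> SI Sbin genS optS; split; first exact: optimal_counts_min.
move=> T [Tbin genT _]; have TI : T `<=` I_L by rewrite -genT; apply: sub_ideal_gen.
pose cl B := [set G | exists2 F, fiber_of L B F & fiber_equiv G F].
have clE u v : u != v -> eqv L u v ->
    cl (binom k u v) = [set G | fiber_equiv G (fiber L u)].
  move=> uv euv; apply/seteqP; split=> G [].
    by move=> F /(fiber_ofP k latL _ uv)[_ ->].
  by move=> GF FG; exists (fiber L u) => //; apply/fiber_ofP.
apply: (card_le_glue (cl := cl)) => B SB; have [u [v [uv eB]]] := Sbin B SB.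
rewrite {}eB in SB *; have euv := sub_lattice_eqv latL SI SB.
have part X : X `<=` I_L -> X `<=` is_binomial k ->
    X `&` [set y | cl y = cl (binom k u v)] = class_part L X (fiber L u).
  move=> XI Xbin; rewrite clE //; apply/seteqP; split=> C.
    move=> [XC clC]; have [a [b [ab eC]]] := Xbin C XC.
    rewrite {}eC in XC clC *; have eab := sub_lattice_eqv latL XI XC.
    apply/class_part_binom => //; split=> //; move: clC; rewrite /= clE // => clC.
    have : [set G | fiber_equiv G (fiber L a)] (fiber L a) by apply: fiber_equiv_refl.
    by rewrite clC.
  move=> CF; have [a [b [ab -> XC eab aF]]] := class_partP latL CF.
  split=> //=; rewrite clE //; apply/seteqP; split=> G GF.
    exact: fiber_equiv_trans aF.
  exact: fiber_equiv_trans (fiber_equiv_sym aF).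
by rewrite !part //; apply: optimal_counts_le.
Qed.

(** A minimal generating set has no superfluous edge in any graph: keeping only
    a spanning tree of one graph still generates. *)
Lemma min_gen_set_counts S f : S `<=` I_L -> min_gen_set I_L S -> ~ insig L f ->
  (class_part L S (fiber L f) #= `I_(fiber_t k L (fiber L f)).-1)%card.
Proof.
move=> SI /[dup] /(min_gen_set_finite latL) finS [Sbin genS minS] nF.
have [walkS gen1] := (generates_walkP latL SI Sbin).1 genS.
pose A := class_part L S (fiber L f).
have finA : finite_set A by apply: sub_finite_set finS; apply: class_part_sub.
have [T [TA cardT walkT]] := spanning_subset latL nF SI finA (walkS f nF).
pose S' := (S `\` A) `|` T.
have S'S : S' `<=` S by move=> B [[]//|/TA[]].
suff eS : S' = S.
  suff -> : class_part L S (fiber L f) = T by [].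
  apply/seteqP; split=> // B AB; have : S' B by rewrite eS; case: AB.
  by case=> // -[_ /(_ AB)].
apply: minS => //.
apply/(generates_walkP latL (subset_trans S'S SI) (subset_trans S'S Sbin)); split.
  move=> g ng; have [gf|ngf] := pselect (fiber_equiv (fiber L g) (fiber L f)).
    move=> u v gu gv; apply: (@walk_mono T); first exact: subsetUr.
    exact: (walk_connected_equiv gf ng walkT).
  apply: walk_connected_other => //; last exact: walkS.
  by move=> /fiber_equiv_sym.
rewrite gen1; congr ideal_gen; apply/seteqP; split=> B; last first.
  by move=> [/S'S SB HB].
move=> BF; have [SB HB] := BF; split=> //; left; split=> // AB.
by apply/nF/(fiber_equiv1P latL); apply: class_part_unique AB BF.
Qed.

(** In a generating set of least cardinality, the class of the fiber of 1 has as
    few binomials as possible, since it could be replaced by [pure_generators];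
    the finiteness of the other classes makes the comparison conclusive. *)
Lemma card_min_counts S : S `<=` I_L -> card_min_gen_set I_L S -> optimal_counts S.
Proof.
move=> SI [minS leS]; have [Sbin genS _] := minS; have finS := min_gen_set_finite latL minS.
have [walkS gen1] := (generates_walkP latL SI Sbin).1 genS.
have cardS f := min_gen_set_counts (f := f) SI minS.
split=> //.
have [T [Tbin cardT TP conT]] := pure_generators k latL.
pose A := class_part L S F1; pose S' := (S `\` A) `|` T.
have TI : T `<=` I_L by move=> _ /TP[a [b [-> _ ab]]]; apply/lattice_idealP.
have T1 : T `<=` class_part L S' F1.
  move=> B TB; have [a [b [nab eB]]] := Tbin B TB; rewrite eB in TB *.
  have [a' [b' [eB' ia' ab']]] := TP _ TB.
  have ab : eqv L a b := sub_lattice_eqv latL TI TB.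
  apply/class_part_binom => //; split=> //; first by right.
  apply/(fiber_equiv1P latL); case: (binom_inj nab eB') => -[-> _] //.
  exact: insig_eqv ab' ia'.
have S'T : class_part L S' F1 = T.
  apply/seteqP; split=> // B BF; have [[[SB nA]|//] HB] := BF.
  by case: nA.
have S'bin : S' `<=` is_binomial k by move=> B [[/Sbin]|/Tbin].
have S'I : S' `<=` I_L by move=> B [[/SI]|/TI].
have genS' : ideal_gen S' = I_L.
  apply/(generates_walkP latL S'I S'bin); split; last first.
    by apply/(class1_genP latL) => u v iu uv; rewrite S'T; apply: conT.
  move=> f nf; apply: walk_connected_other => //; last exact: walkS.
  by move=> /fiber_equiv_sym/(fiber_equiv1P latL).
have cardT_eq : (T #= `I_r)%card.
  rewrite card_eq_le cardT -S'T; apply: rank_le_class1 => //.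
  by have [] := (generates_walkP latL S'I S'bin).1 genS'.
have optS' : optimal_counts S'.
  split=> [f nf|]; last by rewrite S'T.
  suff -> : class_part L S' (fiber L f) = class_part L S (fiber L f) by apply: cardS.
  apply/seteqP; split=> B BF; have [SB HB] := BF; split=> //.
    case: SB => [[]//|/T1 B1].
    by have := class_part_unique BF B1 => /(fiber_equiv1P latL).
  left; split=> // AB; have := class_part_unique BF AB.
  by move=> /(fiber_equiv1P latL).
have leS' := leS S' (optimal_counts_min S'I S'bin genS' optS').
have finA : finite_set A by apply: sub_finite_set finS; apply: class_part_sub.
have finT : finite_set T := card_le_finite cardT (finite_II _).
have /finite_setP[m cardA] := finA.
have m_le : (m <= r)%N.
  have finR : finite_set (S `\` A) by apply: sub_finite_set finS => B [].
  have finS' : finite_set S' by rewrite finite_setU.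
  have /finite_setP[s cardS0] := finS; rewrite (card_le_eql cardS0) in leS'.
  have := leq_card_fset_set finS' leS'; rewrite -(card_fset_set cardS0).
  rewrite fset_setU // cardfsU.
  rewrite (card_fset_set cardT_eq) fset_setD //.
  rewrite -(cardfsID (fset_set A) (fset_set S)).
  have -> : (fset_set S `&` fset_set A)%fset = fset_set A.
    by apply/fsetIidPr; rewrite -fset_set_sub //; apply: class_part_sub.
  rewrite (card_fset_set cardA); lia.
rewrite card_eq_le -/A (card_le_eql cardA) card_le_II m_le /=.
exact: rank_le_class1.
Qed.

(** * Characterization of the cardinality-minimal generating sets *)

Lemma spanning_tree_insig S f : insig L f -> gamma_spanning_tree L S (fiber L f).
Proof.
move=> iF; split.
- exists (component k (fiber L f) (restr_sigma L f)); apply/gamma_vertP => //.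
  by exists f => //; apply: eqv_refl.
- move=> C D VC VD; rewrite (gamma_vert_insig latL iF VC VD).
  by exists [::].
move=> [|C [|D c]] // _ /andP[/= /andP[/asboolP[VC VD CD _] _] _].
by case: CD; apply: gamma_vert_insig VD.
Qed.

Lemma spanning_tree_walk S f : S `<=` I_L -> ~ insig L f ->
  gamma_spanning_tree L S (fiber L f) -> walk_connected L f S.
Proof.
move=> SI nF [_ conS _]; apply: (gamma_connectedP latL nF SI).1 => C D VC VD.
by apply/connected_rst; [apply: gamma_edge_sym|apply: conS].
Qed.

End Main.

Theorem theorem4p12 (k : fieldType) (n : nat) (L : set 'rV[int]_n)
    (S : set {mpoly k[n]}) (latL : is_lattice L)
    (SI : S `<=` lattice_ideal k L) (Sbin : S `<=` is_binomial k) :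
  card_min_gen_set (lattice_ideal k L) S <->
  [/\ (forall F, is_fiber L F -> gamma_spanning_tree L S F)
      /\ (forall F, is_fiber L F -> ~ fiber_equiv F (fiber1 L) ->
            (class_part L S F #= `I_(fiber_t k L F).-1)%card),
      (class_part L S (fiber1 L) #= `I_(lattice_rank (lattice_pure L)))%card
    & lattice_ideal k (lattice_pure L) =
        ideal_gen (class_part L S (fiber1 L))].
Proof.
split=> [minS|[[treeS cardS] cardS1 gen1]].
  have [cardS cardS1] := card_min_counts latL SI minS.
  have [[_ genS _] _] := minS.
  have [walkS gen1] := (generates_walkP latL SI Sbin).1 genS.
  split=> //; split=> _ [f ->]; last first.
    by move=> nf; apply: cardS => iF; apply/nf/(fiber_equiv1P latL).
  have [iF|nF] := pselect (insig L f); first exact: spanning_tree_insig.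
  by apply: gamma_tree => //; [apply: walkS|apply: cardS].
have nequiv f : ~ insig L f -> ~ fiber_equiv (fiber L f) (fiber1 L).
  by move=> nF /(fiber_equiv1P latL).
apply: optimal_counts_card_min => //.
  apply/(generates_walkP latL SI Sbin); split=> // f nF.
  by apply: spanning_tree_walk => //; apply: treeS; exists f.
by split=> // f nF; apply: cardS; [exists f|apply: nequiv].
Qed.
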